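(* There exist two numerical constants $c_1, c_2>0$ such that for any rooted tree $\mathcal{T}$ (locally finite, without leaves) satisfying $$2\le D_{min}(\mathcal{T}) = \inf_{v\in \mathcal{T}} D(v) \le \sup_{v\in \mathcal{T}} D(v) = D_{max}(\mathcal{T})<\infty$$ and any finite sequence $\alpha = (\alpha_k)_{k=1}^N$ of real numbers, $$c_1 \sqrt{\log D_{min}(\mathcal{T})}\cdot Q(\alpha) \le \Big(\mathbb{E}\Big[ \sup_{|v|\le N} G(\mathcal{T}, \alpha; v)^2\Big]\Big)^{1/2} \le c_2 \sqrt{\log D_{max}(\mathcal{T})} \cdot Q(\alpha).$$
   Context: All rooted trees $\mathcal{T}$ are assumed locally finite and without leaves. The root is denoted $\rho$, $d(\cdot,\cdot)$ is the graph distance, $|v|=d(\rho,v)$, and $\preccurlyeq$ is the natural partial order ($u\preccurlyeq v$ iff $u$ lies on the geodesic from $\rho$ to $v$). For $v\in\mathcal{T}$, $D(v)=\#\{u\in \mathcal{T}: v\preccurlyeq u \text{ and } d(u,v)=1\}$ is the number of children of $v$. $(Z(v))_{v\in\mathcal{T}}$ is a family of independent standard Gaussian $N(0,1)$ random variables. With the convention $\alpha_0=0$, set $G(\mathcal{T},\alpha;v)=\sum_{u\preccurlyeq v}\alpha_{|u|}Z(u)$ for $v\in\mathcal{T}$ with $|v|\le N$. A finite sequence is regarded as an infinite one by setting $\alpha_k=0$ for $k>N$, and $Q(\alpha)=\sum_{l=0}^\infty\Big(\frac{1}{l+1}\sum_{k=l+1}^\infty\alpha_k^2\Big)^{1/2}$.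 *)

(* Defs.v *)
From HB Require Import structures.
From mathcomp Require Import all_boot all_order all_algebra finmap.
From mathcomp Require Import all_classical all_reals all_analysis.

Set Implicit Arguments.
Unset Strict Implicit.
Unset Printing Implicit Defensive.

Import Order.TTheory GRing.Theory Num.Theory.
Import numFieldNormedType.Exports.

Local Open Scope classical_set_scope.
Local Open Scope ring_scope.

(* In mathcomp's [path], the sequence [x :: p] lists the vertices of the walk,
   so [size p] is its number of edges. *)
Definition walk (V : eqType) (e : rel V) (x y : V) (p : seq V) : bool :=
  path e x p && (last x p == y).

(* Every edge xy gives the degenerate [ucycle] [:: x; y]; genuine cycles have
   at least three vertices. *)
Record rooted_tree : Type := RootedTree {
  vertex :> choiceType;
  adj : rel vertex;
  root : vertex;
  adj_sym : symmetric adj;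
  adj_irrefl : irreflexive adj;
  adj_connected : forall x y : vertex, exists p, walk adj x y p;
  adj_acyclic : forall c : seq vertex, ucycle adj c -> (size c <= 2)%N }.

Section Trees.
Variable T : rooted_tree.
Implicit Types u v : T.

Lemma ex_walk_size u v : exists n,
  `[< exists2 p, walk (@adj T) u v p & size p = n >].
Proof.
by have [p uvp] := adj_connected u v; exists (size p); apply/asboolP; exists p.
Qed.

Definition dist u v : nat := ex_minn (ex_walk_size u v).

Definition geodesic u v (p : seq T) : bool :=
  walk (@adj T) u v p && (size p == dist u v).

Definition height v : nat := dist (root T) v.

Definition tree_le u v : Prop :=
  exists2 p, geodesic (root T) v p & u \in root T :: p.

Definition children v : set T := [set u | tree_le v u /\ dist u v = 1%N].

Definition nb_children v : nat := #|` fset_set (children v)|.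

Definition locally_finite : Prop :=
  forall v, finite_set [set u | adj v u].

Definition without_leaves : Prop := forall v, children v !=set0.

Definition Dmin (R : realType) : \bar R :=
  ereal_inf [set ((nb_children v)%:R)%:E | v in [set: T]].

Definition Dmax (R : realType) : \bar R :=
  ereal_sup [set ((nb_children v)%:R)%:E | v in [set: T]].

End Trees.

Arguments Dmin T R : clear implicits.
Arguments Dmax T R : clear implicits.

(* The tuple [a] stores alpha_1, ..., alpha_N; the extension satisfies
   alpha_0 = 0 and alpha_k = 0 for k > N. *)
Definition extend (R : realType) (N : nat) (a : N.-tuple R) : nat -> R :=
  fun k => (0 :: a)`_k.

Definition Q (R : realType) (alpha : nat -> R) : \bar R :=
  (\sum_(0 <= l <oo)
     sqrte ((l.+1%:R^-1)%:E * \sum_(l.+1 <= k <oo) (alpha k ^+ 2)%:E))%E.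

Definition mutually_independent (d : measure_display) (Omega : measurableType d)
    (R : realType) (P : probability Omega R) (I : choiceType)
    (X : I -> {RV P >-> R}) : Prop :=
  forall (J : {fset I}) (B : I -> set R), (forall i, measurable (B i)) ->
    P (\bigcap_(i in [set` J]) (X i @^-1` B i)) =
    (\prod_(i <- J) P (X i @^-1` B i))%E.

(* [normal_prob m s] has mean m and standard deviation s. *)
Definition standard_gaussian (d : measure_display) (Omega : measurableType d)
    (R : realType) (P : probability Omega R) (X : {RV P >-> R}) : Prop :=
  forall B : set R, measurable B -> distribution P X B = normal_prob 0 1 B.

(* The index set of the sum is finite, so the finitely supported sum
   [\sum_(_ \in _)] is the actual sum. *)
Definition G (d : measure_display) (Omega : measurableType d)
    (R : realType) (P : probability Omega R) (T : rooted_tree)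
    (Z : T -> {RV P >-> R}) (alpha : nat -> R) (v : T) (w : Omega) : R :=
  \sum_(u \in [set u | tree_le u v]) alpha (height u) * Z u w.

(* Main.v *)
Require Import Defs.
From HB Require Import structures.
From mathcomp Require Import all_boot all_order all_algebra finmap.
From mathcomp Require Import all_classical all_reals all_analysis.
From mathcomp Require Import measurable_realfun ring lra zify.

(** Both bounds go through the dyadic blocks of levels 2^b <= k < 2^(b+1).  If
    blockvar b is the sum of alpha_k^2 over the block, then Q(alpha) is
    comparable to the sum W of the square roots of 2^b * blockvar b
    (blocksum_le_Qsum, Qsum_le_blocksum).

    Upper bound.  Along a path the field is the sum over b of its increments
    in the blocks.  Levels below 2^(b+1) contain at most D_max^(2^(b+1))
    vertices, so the increments in block b take at most that many values, each
    of variance at most blockvar b, and the expected maximum of their squares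
    is at most a constant times 2^b * blockvar b * log D_max
    (gaussian_mgf_max, upper_block).  A weighted Cauchy-Schwarz inequality
    adds up the blocks (weighted_Cauchy_Schwarz, upper_bound).

    Lower bound.  A random path is built greedily from the root, and the mean
    of the field at its end is bounded from below.  To exploit block b, start
    from a vertex u of height at most 2^(b-1).  It has at least D_min^(2^b/2)
    descendants x at height 2^b; each x is continued in some arbitrary way to
    the end of the block, and the increments over the block of these
    continuations live on disjoint sets of vertices, hence are independent.
    Looking at the candidates one after another, the first whose increment
    exceeds a suitable multiple of sqrt(2^b * blockvar b * log D_min) is kept;
    the increment kept has mean at least a constant times this quantity
    (gaussian_mgf_tail, select_mean_ge).  What happens between u and x, and after
    the end of the block, is independent of this choice, so it adds its own
    mean (lower_step).  The levels just before the block are spent on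
    branching, so a path can exploit only every second block; of the even
    and the odd blocks, one family carries half of W (lower_chain,
    lower_estimate).

    All that is used of the Gaussian law is the moment generating function of
    linear combinations, which independence multiplies (gaussian_mgf_lincomb).
    It yields integrability, mean zero, the maximal inequality and the lower
    tail bound. *)

Set Implicit Arguments.
Unset Strict Implicit.
Unset Printing Implicit Defensive.

Import Order.TTheory GRing.Theory Num.Theory.
Import numFieldNormedType.Exports.

Local Open Scope classical_set_scope.
Local Open Scope ring_scope.

(** * Independence of the sigma-algebras of disjoint subfamilies *)

Section independence.
Context (d : measure_display) (Omega : measurableType d) (R : realType)
  (P : probability Omega R) (I : choiceType) (Z : I -> {RV P >-> R}).

(** Finite intersections are included to make this generating family of the
    sigma-algebra of the subfamily indexed by [J] a pi-system. *)
Definition cylinder (J : set I) : set (set Omega) :=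
  [set A | exists (K : {fset I}) (B : I -> set R),
    [/\ [set` K] `<=` J, forall i, measurable (B i) &
        A = \bigcap_(i in [set` K]) (Z i @^-1` B i)]].

Lemma cylinder_setI (J : set I) : setI_closed (cylinder J).
Proof.
move=> _ _ [K [B [KJ mB ->]]] [K' [B' [KJ' mB' ->]]].
exists (K `|` K')%fset,
  (fun i => (if i \in K then B i else setT) `&` (if i \in K' then B' i else setT)).
split.
- by move=> i /=; rewrite inE => /orP[/KJ|/KJ'].
- by move=> i; apply: measurableI; case: ifP.
- apply/seteqP; split => w /=.
    move=> [h h'] i /=; rewrite inE => iK; split; case: ifPn => // ik.
      exact: (h i).
    exact: (h' i).
  move=> h; split => i /= iK.
    by have := h i; rewrite /= inE iK /= => /(_ isT)[].
  by have := h i; rewrite /= inE iK orbT /= => /(_ isT)[].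
Qed.

Lemma cylinder_measurable (J : set I) : cylinder J `<=` measurable.
Proof.
move=> _ [K [B [KJ mB ->]]]; apply: fin_bigcap_measurable => //.
by move=> i _; rewrite -[X in measurable X]setTI; exact: measurable_funP.
Qed.

Lemma sigma_cylinder_measurable (J : set I) : <<s cylinder J >> `<=` measurable.
Proof.
apply: smallest_sub; last exact: cylinder_measurable.
exact: sigma_algebra_measurable.
Qed.

Lemma cylinder_sub (J J' : set I) : J `<=` J' -> cylinder J `<=` cylinder J'.
Proof.
by move=> JJ' _ [K [B [KJ mB ->]]]; exists K, B; split => //; apply: subset_trans JJ'.
Qed.

(** The pi-lambda theorem reduces independence of sigma-algebras to this
    closure property: independence of a fixed event defines a Dynkin system. *)
Lemma indep_dynkin (B : set Omega) : measurable B ->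
  dynkin [set A | measurable A /\ P (A `&` B) = (P A * P B)%E].
Proof.
move=> mB; split.
- by split => //; rewrite setTI probability_setT mul1e.
- move=> A [mA PAB]; split; first exact: measurableC.
  rewrite setIC -setDE measureD //; last by rewrite ltey_eq fin_num_measure.
  transitivity (P B - P A * P B)%E; first by rewrite -PAB setIC.
  by rewrite probability_setC// muleBl ?fin_num_measure ?mul1e//.
- move=> F tF FP; split; first by apply: bigcup_measurable => k _; case: (FP k).
  have mF k : measurable (F k) by case: (FP k).
  rewrite setI_bigcupl measure_bigcup//; last 2 first.
  + by move=> k _; exact: measurableI.
  + by apply: trivIset_setIr.
  rewrite measure_bigcup// [RHS]muleC -(@fineK _ (P B)) ?fin_num_measure//.
  rewrite -nneseriesZl//.
  by apply: eq_eseriesr => k _; rewrite fineK ?fin_num_measure// muleC; case: (FP k).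
Qed.

Hypothesis indZ : mutually_independent Z.

Lemma indep_cylinder (J J' : set I) (A B : set Omega) : J `&` J' = set0 ->
  cylinder J A -> cylinder J' B -> P (A `&` B) = (P A * P B)%E.
Proof.
move=> JJ' [K [C [KJ mC ->]]] [K' [C' [KJ' mC' ->]]].
have KK' i : i \in K -> i \in K' -> False.
  by move=> /KJ Ji /KJ' J'i; have : (J `&` J') i by []; rewrite JJ'.
pose D i := if i \in K then C i else C' i.
have -> : \bigcap_(i in [set` K]) (Z i @^-1` C i) =
          \bigcap_(i in [set` K]) (Z i @^-1` D i).
  by apply: eq_bigcapr => i /= iK; rewrite /D iK.
have -> : \bigcap_(i in [set` K']) (Z i @^-1` C' i) =
          \bigcap_(i in [set` K']) (Z i @^-1` D i).
  by apply: eq_bigcapr => i /= iK; rewrite /D; case: ifPn => // /KK' /(_ iK).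
have mD i : measurable (D i) by rewrite /D; case: ifP.
rewrite -bigcap_setU -set_fsetU !indZ//.
have KE : [fset i in K `|` K' | i \in K]%fset = K.
  by apply/fsetP => i; rewrite !inE /=; case: (i \in K); rewrite ?andbF.
have KE' : [fset i in K `|` K' | i \notin K]%fset = K'.
  apply/fsetP => i; rewrite !inE /=; have := KK' i.
  by case: (i \in K) => [/(_ isT)|_]; case: (i \in K') => // /(_ isT).
by rewrite (@big_fsetID _ _ _ _ (fun i => i \in K)) /= KE KE'.
Qed.

(** The pi-lambda theorem is applied twice, once in each event: first
    cylinders are replaced by general events on the left, then on the right. *)
Lemma indep_sigma (J J' : set I) (A B : set Omega) : J `&` J' = set0 ->
  <<s cylinder J >> A -> <<s cylinder J' >> B -> P (A `&` B) = (P A * P B)%E.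
Proof.
move=> JJ' sA sB.
have step1 : forall B, cylinder J' B -> P (A `&` B) = (P A * P B)%E.
  move=> C cC.
  suff : <<s cylinder J >> `<=`
      [set A | measurable A /\ P (A `&` C) = (P A * P C)%E] by move=> /(_ A sA)[].
  apply: lambda_system_subset => //; first exact: cylinder_setI.
    by apply/dynkin_lambda_system/indep_dynkin; exact: cylinder_measurable cC.
  move=> D cD; split; first exact: cylinder_measurable cD.
  exact: indep_cylinder cD cC.
have mA := sigma_cylinder_measurable sA.
suff : <<s cylinder J' >> `<=`
    [set B | measurable B /\ P (B `&` A) = (P B * P A)%E].
  by move=> /(_ B sB)[_]; rewrite setIC muleC.
apply: lambda_system_subset => //; first exact: cylinder_setI.
  exact/dynkin_lambda_system/indep_dynkin.
move=> D cD; split; first exact: cylinder_measurable cD.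
by rewrite setIC muleC; exact: step1.
Qed.

End independence.

(** * Expectations of products of independent functions *)

Section indep_expectation.
Context (d : measure_display) (Omega : measurableType d) (R : realType)
  (P : probability Omega R).

(** Independence says that the joint law is the product of the laws, and on
    a product Tonelli factorizes the integral of a product function. *)
Lemma indep_integralM (X Y : {RV P >-> R}) :
  (forall w, 0 <= X w) -> (forall w, 0 <= Y w) ->
  (forall A B, measurable A -> measurable B ->
     P (X @^-1` A `&` Y @^-1` B) = (P (X @^-1` A) * P (Y @^-1` B))%E) ->
  (\int[P]_w (X w * Y w)%:E = (\int[P]_w (X w)%:E) * (\int[P]_w (Y w)%:E))%E.
Proof.
move=> X0 Y0 XY.
have mXY : measurable_fun setT (fun w => (X w, Y w)) by exact: measurable_fun_pair.
pose f (z : R * R) : \bar R := (`|z.1| * `|z.2|)%:E.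
have mf : measurable_fun setT f.
  apply/measurable_EFinP; apply: measurable_funM; apply: measurableT_comp => //.
have -> : (\int[P]_w (X w * Y w)%:E = \int[pushforward P (fun w => (X w, Y w))]_z f z)%E.
  rewrite ge0_integral_pushforward//.
    by apply: eq_integral => w _; rewrite /f /= !ger0_norm.
  by move=> z _; rewrite /f lee_fin mulr_ge0.
have -> : (\int[pushforward P (fun w => (X w, Y w))]_z f z =
     \int[distribution P X \x distribution P Y]_z f z)%E.
  apply: eq_measure_integral => //= A mA _.
  rewrite (@product_measure_unique _ _ _ _ _ (distribution P X) (distribution P Y)
     (pushforward P (fun w => (X w, Y w))))//.
rewrite fubini_tonelli1//.
have inner x : fubini_F (distribution P Y) f x = (`|x|%:E * \int[P]_w (Y w)%:E)%E.
  rewrite /fubini_F /f /=.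
  under eq_integral do rewrite EFinM.
  rewrite ge0_integralZl//; last first.
    by apply/measurable_EFinP; exact: (@normr_measurable R setT).
  congr (_ * _)%E; rewrite ge0_integral_distribution//.
    by apply: eq_integral => w _; rewrite /= ger0_norm.
  by apply/measurable_EFinP; exact: (@normr_measurable R setT).
under eq_integral do rewrite inner.
rewrite ge0_integralZr//; last 2 first.
  by apply/measurable_EFinP; exact: (@normr_measurable R setT).
  by apply: integral_ge0 => w _; rewrite lee_fin.
congr (_ * _)%E; rewrite ge0_integral_distribution//.
- by apply: eq_integral => w _; rewrite /= ger0_norm.
- by apply/measurable_EFinP; exact: (@normr_measurable R setT).
- by move=> x; rewrite lee_fin mulr_ge0.
Qed.

End indep_expectation.

Lemma measurable_sum_seq (d : measure_display) (T : measurableType d)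
    (R : realType) (K : eqType) (s : seq K) (f : K -> T -> R) :
  (forall k, k \in s -> measurable_fun setT (f k)) ->
  measurable_fun setT (fun w => \sum_(k <- s) f k w).
Proof.
elim: s => [|k s IH] h.
  by under eq_fun do rewrite big_nil; exact: measurable_cst.
under eq_fun do rewrite big_cons.
apply: measurable_funD; first by apply: h; rewrite mem_head.
by apply: IH => j js; apply: h; rewrite inE js orbT.
Qed.

Section functions_of_subfamily.
Context (d : measure_display) (Omega : measurableType d) (R : realType)
  (P : probability Omega R) (I : choiceType) (Z : I -> {RV P >-> R}).

(** [f] is a function of the variables indexed by [J] only: [Omega] is given
    the sigma-algebra of this subfamily instead of its own. *)
Definition meas_on (J : set I) (f : Omega -> R) : Prop :=
  measurable_fun setT (f : g_sigma_algebraType (cylinder Z J) -> R).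

Lemma meas_on_measurable J f : meas_on J f -> measurable_fun setT f.
Proof.
move=> mf mT B mB; rewrite setTI; apply: (@sigma_cylinder_measurable _ _ _ _ _ Z J).
by rewrite -[X in _ X]setTI; exact: mf.
Qed.

Lemma meas_on_preimage J f B : meas_on J f -> measurable B ->
  <<s cylinder Z J >> (f @^-1` B).
Proof. by move=> mf mB; rewrite -[X in _ X]setTI; exact: mf. Qed.

Lemma meas_on_sub J J' f : J `<=` J' -> meas_on J f -> meas_on J' f.
Proof.
move=> JJ' mf mT B mB; have := mf measurableT B mB.
apply: (@sub_smallest2r _ (sigma_algebra setT) (cylinder Z J) (cylinder Z J')).
  exact: smallest_sigma_algebra.
exact: cylinder_sub.
Qed.

Lemma meas_on_var (J : set I) i : J i -> meas_on J (Z i).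
Proof.
move=> Ji mT B mB; rewrite setTI; apply: sub_sigma_algebra.
exists [fset i]%fset, (fun=> B); split => //.
  by move=> j /=; rewrite inE => /eqP ->.
apply/seteqP; split => w /=.
  by move=> h j /=; rewrite inE => /eqP ->.
by apply; rewrite /= inE.
Qed.

Lemma meas_on_sum (J : set I) (K : eqType) (s : seq K) (f : K -> Omega -> R) :
  (forall k, k \in s -> meas_on J (f k)) ->
  meas_on J (fun w => \sum_(k <- s) f k w).
Proof. exact: measurable_sum_seq. Qed.

Hypothesis indZ : mutually_independent Z.

Lemma indep_integral_ge0 (J J' : set I) (X Y : Omega -> R) : J `&` J' = set0 ->
  meas_on J X -> meas_on J' Y -> (forall w, 0 <= X w) -> (forall w, 0 <= Y w) ->
  (\int[P]_w (X w * Y w)%:E = (\int[P]_w (X w)%:E) * (\int[P]_w (Y w)%:E))%E.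
Proof.
move=> JJ' mX mY X0 Y0.
pose X' : {RV P >-> R} := HB.pack X
  (isMeasurableFun.Build _ _ _ _ X (meas_on_measurable mX)).
pose Y' : {RV P >-> R} := HB.pack Y
  (isMeasurableFun.Build _ _ _ _ Y (meas_on_measurable mY)).
apply: (@indep_integralM _ _ _ P X' Y') => // A B mA mB.
by apply: (indep_sigma indZ JJ'); exact: meas_on_preimage.
Qed.

Lemma integrable_event (A : set Omega) (Y : Omega -> R) : measurable A ->
  P.-integrable setT (EFin \o Y) -> 
  P.-integrable setT (EFin \o (fun w => \1_A w * Y w)).
Proof.
move=> mA iY; apply: (le_integrable measurableT _ _ iY) => //.
  apply/measurable_EFinP; apply: measurable_funM => //.
  by apply/measurable_EFinP; exact: measurable_int iY.
move=> w _; rewrite /= lee_fin normrM ler_piMl//.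
by rewrite indicE; case: (w \in A); rewrite ?normr1 ?normr0.
Qed.

(** The nonnegative case applies to the positive and negative parts of [Y]. *)
Lemma indep_integral_event (J J' : set I) (A : set Omega) (Y : Omega -> R) :
  J `&` J' = set0 -> <<s cylinder Z J >> A -> meas_on J' Y ->
  P.-integrable setT (EFin \o Y) ->
  \int[P]_w (\1_A w * Y w) = fine (P A) * \int[P]_w (Y w).
Proof.
move=> JJ' sA mY iY.
have mA : measurable A by exact: sigma_cylinder_measurable sA.
have m1A : meas_on J (\1_A : Omega -> R).
  by apply: (@measurable_indic _ (g_sigma_algebraType (cylinder Z J)) R setT A).
have ge0 (Y' : Omega -> R) : meas_on J' Y' -> (forall w, 0 <= Y' w) ->
    P.-integrable setT (EFin \o Y') -> \int[P]_w (\1_A w * Y' w) = fine (P A) * \int[P]_w (Y' w).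
  move=> mY' Y'0 iY'; rewrite /Rintegral (indep_integral_ge0 JJ' m1A mY')//.
  by rewrite integral_indic// setIT fineM ?fin_num_measure// integrable_fin_num.
have iYp : P.-integrable setT (EFin \o (fun w => Num.max (Y w) 0)).
  apply: (le_integrable measurableT _ _ iY) => //.
    apply/measurable_EFinP; apply: measurable_maxr => //.
    exact: meas_on_measurable mY.
  move=> w _; rewrite /= lee_fin ger0_norm ?le_max ?lexx ?orbT//.
  by rewrite ge_max normr_ge0 ler_norm.
have iYm : P.-integrable setT (EFin \o (fun w => Num.max (- Y w) 0)).
  apply: (le_integrable measurableT _ _ iY) => //.
    apply/measurable_EFinP; apply: measurable_maxr => //.
    by apply: measurableT_comp => //; exact: meas_on_measurable mY.
  move=> w _; rewrite /= lee_fin ger0_norm ?le_max ?lexx ?orbT//.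
  by rewrite ge_max normr_ge0 -normrN ler_norm.
have YE w : Y w = Num.max (Y w) 0 - Num.max (- Y w) 0.
  case: (leP (Y w) 0) => Yw; first by rewrite max_l ?oppr_ge0// opprK add0r.
  by rewrite max_r ?subr0// oppr_le0 ltW.
transitivity (\int[P]_w (\1_A w * Num.max (Y w) 0 - \1_A w * Num.max (- Y w) 0)).
  by apply: eq_Rintegral => w _; rewrite {1}YE mulrBr.
rewrite RintegralB//; try exact: integrable_event.
transitivity (fine (P A) * \int[P]_w (Num.max (Y w) 0 - Num.max (- Y w) 0)).
  rewrite RintegralB// mulrBr !ge0//.
  - by apply: measurable_maxr => //; apply: measurableT_comp => //.
  - by move=> w; rewrite le_max lexx orbT.
  - by apply: measurable_maxr.
  - by move=> w; rewrite le_max lexx orbT.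
by congr (_ * _); apply: eq_Rintegral => w _; rewrite -YE.
Qed.

End functions_of_subfamily.

(** * Variables with a Gaussian moment generating function *)

Section normal.
Context (R : realType).
Local Notation mu := (@lebesgue_measure R).
Let nu : {finite_measure set (measurableTypeR R) -> \bar R} := normal_prob (0 : R) 1.
Local Notation RN := (Radon_Nikodym_SigmaFinite.f nu mu).

(** The normal density is a Radon-Nikodym derivative, by uniqueness. *)
Lemma ge0_integral_normal_prob (f : R -> \bar R) : (forall x, 0 <= f x)%E ->
  measurable_fun setT f ->
  (\int[normal_prob 0 1]_x f x = \int[mu]_x (f x * (normal_pdf 0 1 x)%:E))%E.
Proof.
move=> f0 mf; have dom : nu `<< mu := normal_prob_dominates (0 : R) 1.
rewrite -(Radon_Nikodym_SigmaFinite.change_of_variables dom f0 measurableT mf)//.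
have iRN : mu.-integrable setT RN.
  exact: Radon_Nikodym_SigmaFinite.f_integrable.
apply: ae_eq_integral => //.
- by apply: emeasurable_funM => //; exact: (measurable_int mu).
- apply: emeasurable_funM => //; apply/measurable_EFinP.
  exact: measurable_normal_pdf.
- apply: ae_eqe_mul2l; apply: integral_ae_eq => //.
    by apply/measurable_EFinP; exact: measurable_normal_pdf.
  by move=> E _ mE; rewrite -Radon_Nikodym_SigmaFinite.f_integral.
Qed.

(** Completing the square turns the tilted density of mean 0 into a multiple
    of the density of mean [a]. *)
Lemma mgf_normal_prob (a : R) :
  (\int[normal_prob 0 1]_x (expR (a * x))%:E = (expR (a ^+ 2 / 2))%:E)%E.
Proof.
rewrite ge0_integral_normal_prob; last 2 first.
  by move=> x; rewrite lee_fin expR_ge0.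
  apply/measurable_EFinP; apply: measurableT_comp => //.
transitivity (\int[mu]_x ((expR (a ^+ 2 / 2))%:E * (normal_pdf a 1 x)%:E))%E.
  apply: eq_integral => x _; rewrite -!EFinM; congr EFin.
  rewrite !normal_pdfE ?oner_neq0// mulrCA [RHS]mulrCA; congr (_ * _).
  by rewrite /normal_fun -!expRD; congr expR; rewrite subr0 !expr1n; field.
rewrite ge0_integralZl//; first by rewrite integral_normal_pdf mule1.
- by apply/measurable_EFinP; exact: measurable_normal_pdf.
- by move=> x _; rewrite lee_fin normal_pdf_ge0.
Qed.

End normal.

Section gaussian_mgf.
Context (d : measure_display) (Omega : measurableType d) (R : realType)
  (P : probability Omega R).
Implicit Types X : Omega -> R.

(** The part of being centred Gaussian with variance [s2] that is used here.
    Unlike the law itself it is immediate for sums of independent variables. *)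
Definition gaussian_mgf X (s2 : R) : Prop :=
  [/\ measurable_fun setT X, 0 <= s2 & forall a : R,
     (\int[P]_w (expR (a * X w))%:E = (expR (a ^+ 2 * s2 / 2))%:E)%E].

Lemma Rintegral_prob_cst (r : R) : \int[P]_w r = r.
Proof.
rewrite Rintegral_cst// (_ : fine _ = 1) ?mulr1//.
by transitivity (fine (P setT)) => //; rewrite probability_setT.
Qed.

Lemma gaussian_mgfN X s2 : gaussian_mgf X s2 -> gaussian_mgf (fun w => - X w) s2.
Proof.
move=> [mX s20 EX]; split => // [|a]; first exact: measurableT_comp.
by under eq_integral do rewrite mulrN -mulNr; rewrite EX sqrrN.
Qed.

Lemma measurable_expR_lin X (a : R) : measurable_fun setT X ->
  measurable_fun setT (fun w => expR (a * X w)).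
Proof. by move=> mX; apply: measurableT_comp => //; exact: measurable_funM. Qed.

Lemma gaussian_mgf_expR_integrable X s2 (a : R) : gaussian_mgf X s2 ->
  P.-integrable setT (EFin \o (fun w => expR (a * X w))).
Proof.
move=> [mX _ EX]; apply/integrableP; split.
  by apply/measurable_EFinP; exact: measurable_expR_lin.
under eq_integral do rewrite /= ger0_norm ?expR_ge0//.
by rewrite EX ltry.
Qed.

Lemma gaussian_mgf_integrable X s2 : gaussian_mgf X s2 ->
  P.-integrable setT (EFin \o X).
Proof.
move=> gX; have [mX _ _] := gX.
have i1 := gaussian_mgf_expR_integrable 1 gX.
have i2 := gaussian_mgf_expR_integrable (-1) gX.
apply: (le_integrable measurableT _ _ (integrableD measurableT i1 i2)) => //.
  by apply/measurable_EFinP.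
move=> w _ /=; rewrite lee_fin [leRHS]ger0_norm ?addr_ge0 ?expR_ge0//.
rewrite mul1r mulN1r.
have := expR_ge1Dx (X w); have := expR_ge1Dx (- X w).
have := expR_ge0 (X w); have := expR_ge0 (- X w).
by move=> h1 h2 h3 h4; case: (ger0P (X w)) => h5; lra.
Qed.

(** From 1 + a E X <= E exp (a X) = exp (a^2 s2 / 2) = 1 + O(a^2) as a tends
    to 0 from above. *)
Lemma gaussian_mgf_mean_le0 X s2 : gaussian_mgf X s2 -> \int[P]_w X w <= 0.
Proof.
move=> gX; have [mX s20 EX] := gX; have iX := gaussian_mgf_integrable gX.
rewrite leNgt; apply/negP; set m := Rintegral _ _ _ => m0.
(* a <= 1, a * s2 <= 1 and a * s2 < m contradict 1 + a m <= exp (a^2 s2 / 2). *)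
pose a := m / ((1 + m) * (1 + s2)).
have D0 : 0 < (1 + m) * (1 + s2) by rewrite mulr_gt0//; lra.
have a0 : 0 < a by rewrite divr_gt0.
have as1 : a * s2 < m.
  rewrite /a mulrAC ltr_pdivrMr// ltr_pM2l//; nra.
have a1 : a * (1 + s2) <= 1.
  by rewrite /a invfM !mulrA mulfVK ?lt0r_neq0//; [rewrite ler_pdivrMr; lra|lra].
have y1 : a ^+ 2 * s2 <= 1.
  have ? : a <= 1 by nra.
  have : a * s2 <= 1 by nra.
  by rewrite expr2 -mulrA; have := mulr_ge0 (ltW a0) s20; nra.
have : 1 + a * m <= expR (a ^+ 2 * s2 / 2).
  have -> : expR (a ^+ 2 * s2 / 2) = \int[P]_w expR (a * X w).
    by rewrite /Rintegral EX.
  have iaX : P.-integrable setT (EFin \o (fun w => a * X w)).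
    by apply: (integrableZl measurableT a iX).
  have i1 : P.-integrable setT (EFin \o (fun w : Omega => 1 : R)).
    exact: finite_measure_integrable_cst.
  have -> : 1 + a * m = \int[P]_w (1 + a * X w).
    by rewrite RintegralD// RintegralZl// Rintegral_prob_cst.
  apply: le_Rintegral => //.
  - exact: (integrableD measurableT i1 iaX).
  - exact: gaussian_mgf_expR_integrable gX.
  - by move=> w _; exact: expR_ge1Dx.
have := expR_ge1Dx (- (a ^+ 2 * s2 / 2)); rewrite expRN.
set y := a ^+ 2 * s2 in y1 *; set e := expR _ => h1 h2.
have e0 : 0 < e by exact: expR_gt0.
have h3 : e * (1 - y / 2) <= 1 by rewrite -ler_pdivlMl// mulr1; lra.
have ty : y < a * m by rewrite /y expr2 -mulrA ltr_pM2l.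
have y0 : 0 <= y by rewrite mulr_ge0// sqr_ge0.
have : (1 + a * m) * (1 - y / 2) <= 1.
  by apply: le_trans h3; rewrite ler_wpM2r//; lra.
move: (a * m) ty => t ty; nra.
Qed.

Lemma gaussian_mgf_mean X s2 : gaussian_mgf X s2 -> \int[P]_w X w = 0.
Proof.
move=> gX; apply/eqP; rewrite eq_le (gaussian_mgf_mean_le0 gX) /=.
have := gaussian_mgf_mean_le0 (gaussian_mgfN gX).
under eq_Rintegral do rewrite -mulN1r.
by rewrite RintegralZl ?mulN1r ?oppr_le0//; exact: gaussian_mgf_integrable gX.
Qed.

End gaussian_mgf.

Section tail.
Context (d : measure_display) (Omega : measurableType d) (R : realType)
  (P : probability Omega R).
Implicit Types X : Omega -> R.

(** The square of 1 - M^(-1/4) at M = 2, the smallest number of candidates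
    that occurs below. *)
Definition tail_const : R := (1 - expR (- (ln 2 / 4))) ^+ 2.

(** A Paley-Zygmund argument for Y = exp (a X) with a = s / sqrt v: the mean
    exp (s^2 / 2) of Y comes from the event where Y exceeds exp (s^2 / 4), up
    to an amount exp (s^2 / 4), and the second moment exp (2 s^2) forces this
    event to have probability of order exp (- s^2). *)
Lemma gaussian_mgf_tail X (v s : R) : gaussian_mgf P X v -> 0 < v -> 0 < s ->
  ln 2 <= s ^+ 2 ->
  tail_const * expR (- s ^+ 2) <= fine (P [set w | Num.sqrt v * s / 4 < X w]).
Proof.
move=> gX v0 s0 s2; have [mX _ EX] := gX.
set A := [set w | _]; set p := fine (P A).
have mA : measurable A.
  rewrite [A](_ : _ = X @^-1` `]Num.sqrt v * s / 4, +oo[%classic).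
    by rewrite -[X in measurable X]setTI; exact: mX.
  by apply/seteqP; split => w; rewrite /A /= in_itv /= andbT.
pose sg := Num.sqrt v.
have sg0 : 0 < sg by rewrite sqrtr_gt0.
have sg2 : v = sg ^+ 2 by rewrite sqr_sqrtr// ltW.
pose a := s / sg.
have asg : a * sg = s by rewrite /a divfK// gt_eqF.
have a0 : 0 < a by rewrite divr_gt0.
pose q := expR (s ^+ 2 / 4).
pose del : R := 1 - expR (- (ln 2 / 4)).
have ln2 : 0 < ln (2 : R) by rewrite ln_gt0// ltr1n.
have del0 : 0 < del by rewrite subr_gt0 expR_lt1; lra.
have q0 : 0 < q by exact: expR_gt0.
have qdel : (1 - del) * q >= 1.
  rewrite /del opprB addrC subrK /q -expRD -[leLHS]expR0 ler_expR; lra.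
have EY : \int[P]_w expR (a * X w) = q ^+ 2.
  rewrite /Rintegral EX /= /q -expRM_natl; congr expR.
  by rewrite sg2 -exprMn asg; field.
have EY2 : \int[P]_w expR (2 * a * X w) = q ^+ 8.
  rewrite /Rintegral EX /= /q -expRM_natl; congr expR.
  by rewrite sg2 -exprMn -(mulrA 2 a) asg; field.
(* e is the near optimal parameter in 2 Y <= e Y^2 + 1 / e on the event. *)
pose e := del / q ^+ 6.
have e0 : 0 < e by rewrite divr_gt0// exprn_gt0.
have iA : P.-integrable setT (EFin \o (\1_A : Omega -> R)).
  exact: integrable_indic.
have iY := gaussian_mgf_expR_integrable a gX.
have iY2 := gaussian_mgf_expR_integrable (2 * a) gX.
have iq : P.-integrable setT (EFin \o (fun w : Omega => q)).
  exact: finite_measure_integrable_cst.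
have i1 : P.-integrable setT (EFin \o (fun w => e / 2 * expR (2 * a * X w))).
  exact: (integrableZl measurableT (e / 2) iY2).
have i2 : P.-integrable setT (EFin \o (fun w => (2 * e)^-1 * \1_A w)).
  exact: (integrableZl measurableT (2 * e)^-1 iA).
have i12 := integrableD measurableT i1 i2.
have main : q ^+ 2 <= q + (e / 2 * q ^+ 8 + (2 * e)^-1 * p).
  rewrite -{1}EY -EY2.
  have -> : p = \int[P]_w (\1_A w).
    by rewrite /Rintegral integral_indic// setIT.
  rewrite -(Rintegral_prob_cst P q) -!RintegralZl// -!RintegralD//.
  apply: le_Rintegral => //.
    exact: (integrableD measurableT iq i12).
  move=> w _; rewrite indicE; case: (boolP (w \in A)) => wA.
    set y := expR (a * X w).
    have -> : expR (2 * a * X w) = y ^+ 2.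
      by rewrite /y -expRM_natl mulrA.
    rewrite mulr1.
    have h : 0 <= (e * y - 1) ^+ 2 / (2 * e).
      by rewrite divr_ge0 ?sqr_ge0// mulr_ge0// ltW.
    have hE : (e * y - 1) ^+ 2 / (2 * e) = e / 2 * y ^+ 2 + (2 * e)^-1 - y.
      by field; rewrite gt_eqF.
    by rewrite hE in h; lra.
  rewrite mulr0 addr0 -[leLHS]addr0 lerD//.
    rewrite ler_expR; move: wA; rewrite notin_setE /A /= => /negP; rewrite -leNgt => wA.
    apply: (@le_trans _ _ (a * (sg * s / 4))); first by rewrite ler_pM2l.
    by rewrite !mulrA asg expr2.
  by rewrite mulr_ge0 ?expR_ge0// divr_ge0// ltW.
have -> : tail_const = del ^+ 2 by [].
have -> : expR (- s ^+ 2) = (q ^+ 4)^-1.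
  by rewrite expRN /q -expRM_natl; congr (expR _)^-1; field.
rewrite ler_pdivrMr ?exprn_gt0//.
have E1 : e / 2 * q ^+ 8 = del / 2 * q ^+ 2.
  by rewrite /e; field; rewrite gt_eqF.
have E2 : (2 * e)^-1 * p = p * q ^+ 6 / (2 * del).
  by rewrite /e; field; rewrite !gt_eqF.
rewrite E1 E2 in main.
have : 2 * del * q ^+ 2 <= 2 * del * q + del ^+ 2 * q ^+ 2 + p * q ^+ 6.
  have := ler_wpM2l (mulr_ge0 (ler0n _ 2) (ltW del0)) main.
  have -> : 2 * del * (q + (del / 2 * q ^+ 2 + p * q ^+ 6 / (2 * del))) =
     2 * del * q + del ^+ 2 * q ^+ 2 + p * q ^+ 6.
    by field; rewrite gt_eqF.
  by [].
move=> h; rewrite -(ler_pM2r (exprn_gt0 2 q0)).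
have -> : p * q ^+ 4 * q ^+ 2 = p * q ^+ 6 by ring.
have : 2 * del * q <= 2 * del * ((1 - del) * q ^+ 2).
  rewrite ler_pM2l ?mulr_gt0//; have := ler_wpM2r (ltW q0) qdel.
  by rewrite mul1r -mulrA -expr2.
nra.
Qed.

End tail.

Section maxima.
Context (d : measure_display) (Omega : measurableType d) (R : realType)
  (P : probability Omega R).

Lemma le_integral_sum (K : eqType) (s : seq K) (f : K -> Omega -> R) (c : K -> R) :
  (forall k, k \in s -> measurable_fun setT (f k)) -> (forall k w, 0 <= f k w) ->
  (forall k, k \in s -> (\int[P]_w (f k w)%:E <= (c k)%:E)%E) ->
  (\int[P]_w (\sum_(k <- s) f k w)%:E <= (\sum_(k <- s) c k)%:E)%E.
Proof.
move=> mf f0 fc; elim: s mf fc => [|k s IH] mf fc.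
  by under eq_integral do rewrite big_nil; rewrite integral0 big_nil.
have sub j : j \in s -> j \in k :: s by rewrite inE => ->; rewrite orbT.
under eq_integral do rewrite big_cons EFinD.
rewrite ge0_integralD//; first last.
- by apply/measurable_EFinP; apply: measurable_sum_seq => j /sub; exact: mf.
- by move=> w _; rewrite lee_fin sumr_ge0.
- by apply/measurable_EFinP; apply: mf; rewrite mem_head.
- by move=> w _; rewrite lee_fin.
rewrite big_cons EFinD leeD//; first by apply: fc; rewrite mem_head.
by apply: IH => j /sub; [exact: mf|exact: fc].
Qed.

(** A square in terms of exponentials: up to 2 u^2 only the excess of |y| over
    [u] matters, and z^2 <= 4 exp z for z >= 0. *)
Lemma sqr_le_expR_sum (u a y : R) : 0 <= u -> 0 < a -> 
  y ^+ 2 <= 2 * u ^+ 2 + 8 / a ^+ 2 * (expR (a * (y - u)) + expR (a * (- y - u))).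
Proof.
move=> u0 a0.
wlog y0 : y / 0 <= y.
  move=> h; case: (leP 0 y) => [/h//|y0].
  by have := h (- y); rewrite oppr_ge0 (ltW y0) sqrrN opprK addrC (addrC (expR _)) addrC => /(_ isT).
have K0 : 0 < 8 / a ^+ 2 by rewrite divr_gt0// exprn_gt0.
have e1 := expR_ge0 (a * (- y - u)).
apply: (@le_trans _ _ (2 * u ^+ 2 + 8 / a ^+ 2 * expR (a * (y - u)))); last first.
  by rewrite lerD2l ler_pM2l// lerDl.
case: (leP y u) => yu.
  have : y ^+ 2 <= u ^+ 2 by rewrite ler_sqr.
  have := mulr_ge0 (ltW K0) (expR_ge0 (a * (y - u))).
  have := sqr_ge0 u; lra.
set z := y - u; have z0 : 0 < z by rewrite subr_gt0.
have az : 0 < a * z by rewrite mulr_gt0.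
have h : (a * z) ^+ 2 / 4 <= expR (a * z).
  have -> : a * z = 2 * (a * z / 2) by field.
  rewrite expRM_natl; set t := a * z / 2; have -> : (2 * t) ^+ 2 / 4 = t ^+ 2 by field.
  have t0 : 0 <= t by rewrite /t; lra.
  rewrite ler_sqr ?nnegrE ?expR_ge0//.
  by apply: le_trans (expR_ge1Dx t); lra.
apply: (@le_trans _ _ (2 * u ^+ 2 + 8 / a ^+ 2 * ((a * z) ^+ 2 / 4))); last first.
  by rewrite lerD2l ler_pM2l.
have -> : 8 / a ^+ 2 * ((a * z) ^+ 2 / 4) = 2 * z ^+ 2.
  by field; rewrite gt_eqF.
have -> : y = z + u by rewrite /z subrK.
have := sqr_ge0 (z - u); nra.
Qed.

Definition max_const : R := 4 + 8 / (ln 2) ^+ 2.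

(** The maximum is replaced by the measurable majorant [H], a sum of
    exponentials; this is a union bound. *)
Lemma gaussian_mgf_max (K : eqType) (s : seq K) (X : K -> Omega -> R) (v M : R) :
  0 < v -> 2 <= M -> (size s)%:R <= M ->
  (forall k, k \in s -> exists2 v', gaussian_mgf P (X k) v' & v' <= v) ->
  exists H : Omega -> R, [/\ measurable_fun setT H, (forall w, 0 <= H w),
    (forall k w, k \in s -> X k w ^+ 2 <= H w) &
    (\int[P]_w (H w)%:E <= (max_const * v * ln M)%:E)%E].
Proof.
move=> v0 M2 sM gX.
have ln2 : 0 < ln (2 : R) by rewrite ln_gt0// ltr1n.
have M0 : 0 < M by apply: lt_le_trans M2.
have L2 : ln 2 <= ln M by rewrite ler_ln// posrE.
set L := ln M in L2 *; have L0 : 0 < L by apply: lt_le_trans L2.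
(* These choices make M times the mean of exp (a (X k - u)) at most 1. *)
pose a := Num.sqrt (2 * L / v).
have a2 : a ^+ 2 = 2 * L / v by rewrite sqr_sqrtr// divr_ge0 ?mulr_ge0 ?ltW.
have a0 : 0 < a by rewrite sqrtr_gt0 divr_gt0// mulr_gt0.
pose u := a * v; have u0 : 0 <= u by rewrite mulr_ge0// ltW.
pose f k w := expR (a * (X k w - u)) + expR (a * (- X k w - u)).
pose H w := 2 * u ^+ 2 + 8 / a ^+ 2 * \sum_(k <- s) f k w.
have f0 k w : 0 <= f k w by rewrite addr_ge0 ?expR_ge0.
have K0 : 0 < 8 / a ^+ 2 by rewrite divr_gt0// exprn_gt0.
have mf k : k \in s -> measurable_fun setT (f k).
  move=> /gX [v' [mX _ _] _].
  by apply: measurable_funD; apply: measurableT_comp => //;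
    apply: measurable_funM => //; apply: measurable_funB => //; apply: measurableT_comp.
have intf k : k \in s -> (\int[P]_w (f k w)%:E <= (2 / M)%:E)%E.
  move=> ks; have [v' gk v'v] := gX k ks; have [mX _ EX] := gk.
  have [_ _ EXN] := gaussian_mgfN gk.
  have -> : (\int[P]_w (f k w)%:E =
     \int[P]_w ((expR (- (a * u)))%:E * (expR (a * X k w))%:E +
        (expR (- (a * u)))%:E * (expR (a * - X k w))%:E))%E.
    apply: eq_integral => w _; rewrite -!EFinM -EFinD -!expRD; congr (_ + _)%:E;
    by congr expR; ring.
  rewrite ge0_integralD//; first last.
  - by apply/measurable_EFinP; apply: measurable_funM => //; apply: measurable_expR_lin; apply: measurableT_comp.
  - by apply/measurable_EFinP; apply: measurable_funM => //; apply: measurable_expR_lin.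
  rewrite !ge0_integralZl//; try (by move=> w _; rewrite lee_fin expR_ge0);
    try (by rewrite lee_fin expR_ge0); last 2 first.
  - by apply/measurable_EFinP; apply: measurable_expR_lin; apply: measurableT_comp.
  - by apply/measurable_EFinP; apply: measurable_expR_lin.
  rewrite EX EXN -EFinM -EFinD lee_fin -expRD.
  have : expR (- (a * u) + a ^+ 2 * v' / 2) <= M^-1.
    have -> : M^-1 = expR (- L) by rewrite expRN lnK ?posrE.
    rewrite ler_expR /u mulrA -expr2 a2.
    have -> : 2 * L / v * v = 2 * L by field; rewrite gt_eqF.
    have -> : 2 * L / v * v' / 2 = L * (v' / v) by field; rewrite gt_eqF.
    have : v' / v <= 1 by rewrite ler_pdivrMr// mul1r.
    nra.
  by lra.
exists H; split.
- apply: measurable_funD => //; apply: measurable_funM => //.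
  exact: measurable_sum_seq.
- move=> w; apply: addr_ge0; first by rewrite mulr_ge0// sqr_ge0.
  by apply: mulr_ge0; [exact: ltW|exact: sumr_ge0].
- move=> k w ks; apply: le_trans (sqr_le_expR_sum _ u0 a0) _.
  rewrite lerD2l ler_pM2l// (big_rem k)//= lerDl.
  by rewrite sumr_ge0.
- rewrite /H; under eq_integral do rewrite EFinD (EFinM (8 / a ^+ 2)).
  have S0 w : 0 <= \sum_(k <- s) f k w by rewrite sumr_ge0.
  have mS : measurable_fun setT (fun w => \sum_(k <- s) f k w) by exact: measurable_sum_seq.
  rewrite ge0_integralD//; first last.
  - by apply/measurable_EFinP; apply: measurable_funM.
  - by move=> w _; rewrite -EFinM lee_fin mulr_ge0// ltW.
  - by move=> w _; rewrite lee_fin mulr_ge0// sqr_ge0.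
  rewrite ge0_integralZl//; last 3 first.
  - by apply/measurable_EFinP.
  - by move=> w _; rewrite lee_fin.
  - by rewrite lee_fin ltW.
  have -> : (\int[P]_x (2 * u ^+ 2)%:E = (2 * u ^+ 2)%:E)%E.
    by rewrite integral_cst// [X in (_ * X)%E]probability_setT mule1.
  apply: (@le_trans _ _ ((2 * u ^+ 2)%:E + (8 / a ^+ 2)%:E * 2%:E)%E).
    rewrite leeD2l// lee_pmul2l// ?lte_fin//; apply: (le_trans (le_integral_sum mf f0 intf)).
    rewrite big_const_seq count_predT iter_addr_0 lee_fin -[_ *+ size s]mulr_natr.
    by rewrite mulrAC ler_pdivrMr// ler_pM2l.
  rewrite -EFinM -EFinD lee_fin /u exprMn a2.
  have -> : 2 * (2 * L / v * v ^+ 2) + 8 / (2 * L / v) * 2 = v * (4 * L + 8 / L).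
    by field; rewrite !gt_eqF.
  have -> : max_const * v * L = v * (4 * L + 8 / ln 2 ^+ 2 * L).
    by rewrite /max_const; field; rewrite gt_eqF.
  rewrite ler_pM2l// lerD2l -mulrA ler_pM2l// mulrC ler_pdivlMr ?exprn_gt0//.
  rewrite mulrC ler_pdivrMr// -expr2 ler_sqr ?nnegrE//; exact: ltW.
Qed.

End maxima.

(** * Linear combinations of independent Gaussian variables, and sequential selection *)

Section lincomb.
Context (d : measure_display) (Omega : measurableType d) (R : realType)
  (P : probability Omega R) (I : choiceType) (Z : I -> {RV P >-> R}).
Hypothesis gZ : forall i, standard_gaussian (Z i).
Hypothesis indZ : mutually_independent Z.

Lemma gaussian_mgf_var i (c : R) : gaussian_mgf P (fun w => c * Z i w) (c ^+ 2).
Proof.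
split => [||a]; [exact: measurable_funM|exact: sqr_ge0|].
have mf : measurable_fun setT (fun x : R => (expR (a * c * x))%:E).
  apply/measurable_EFinP; apply: measurableT_comp => //.
under eq_integral do rewrite mulrA.
transitivity (\int[distribution P (Z i)]_x (expR (a * c * x))%:E)%E.
  by rewrite ge0_integral_distribution// => x; rewrite lee_fin expR_ge0.
rewrite -exprMn -(mgf_normal_prob (a * c)).
(* normal_prob is a measure on a copy of the measurable space R. *)
pose toR (x : measurableTypeR R) : R := x.
have mtoR : measurable_fun setT toR.
  by move=> _ B mB; rewrite setTI.
transitivity (\int[pushforward (normal_prob (0 : R) 1) toR]_x (expR (a * c * x))%:E)%E.
  by apply: eq_measure_integral => A mA _; exact: gZ.
by rewrite ge0_integral_pushforward// => x _; rewrite lee_fin expR_ge0.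
Qed.

Lemma meas_on_scaled_var (J : set I) i (c : R) : J i ->
  meas_on Z J (fun w => c * Z i w).
Proof.
by move=> Ji; apply: measurable_funM => //; apply: meas_on_var Ji.
Qed.

Lemma meas_on_lincomb (J : set I) (s : seq I) (c : I -> R) :
  (forall i, i \in s -> J i) -> meas_on Z J (fun w => \sum_(i <- s) c i * Z i w).
Proof.
by move=> sJ; apply: meas_on_sum => i /sJ; exact: meas_on_scaled_var.
Qed.

(** The moment generating functions of independent variables multiply. *)
Lemma gaussian_mgf_lincomb (s : seq I) (c : I -> R) : uniq s ->
  gaussian_mgf P (fun w => \sum_(i <- s) c i * Z i w) (\sum_(i <- s) c i ^+ 2).
Proof.
elim: s => [_|i s IH /= /andP[is_ us]].
  split => [||a].
  - by under eq_fun do rewrite big_nil; exact: measurable_cst.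
  - by rewrite big_nil.
  - under eq_integral do rewrite big_nil mulr0.
    by rewrite big_nil mulr0 mul0r integral_cst// expR0 mul1e [LHS]probability_setT.
have [mS S0 ES] := IH us.
have [mi _ Ei] := gaussian_mgf_var i (c i).
split => [||a].
- by under eq_fun do rewrite big_cons; exact: measurable_funD.
- by rewrite big_cons addr_ge0// sqr_ge0.
- under eq_integral do rewrite big_cons mulrDr expRD.
  have mexp J (f : Omega -> R) : meas_on Z J f ->
      meas_on Z J (fun w => expR (a * f w)).
    by move=> mf; apply: measurableT_comp => //; exact: measurable_funM.
  rewrite (@indep_integral_ge0 _ _ _ _ _ Z indZ [set i] [set` s]).
  + by rewrite Ei ES -EFinM -expRD big_cons; congr (expR _)%:E; field.
  + apply/seteqP; split => // j [/= -> js].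
    by rewrite js in is_.
  + by apply: (mexp _ (fun w => c i * Z i w)); apply: meas_on_scaled_var.
  + by apply: (mexp _ (fun w => \sum_(j <- s) c j * Z j w)); apply: meas_on_lincomb.
  + by move=> w; exact: expR_ge0.
  + by move=> w; exact: expR_ge0.
Qed.

Section selection.
Variables (K : eqType) (S : K -> set I) (A B : K -> Omega -> R) (x0 : K).
Variables (q t p : R).

(** The value A k + B k of the first candidate [k] in the list with B k > t, or
    that of the default candidate [x0] if there is none.  The default
    candidate is not tested, so that its [B] still has mean 0 when all tests
    fail. *)
Fixpoint select (s : seq K) (w : Omega) : R :=
  if s is k :: s' then
    \1_[set w | t < B k w] w * (A k w + B k w) +
    \1_(~` [set w | t < B k w]) w * select s' w
  else A x0 w + B x0 w.

Lemma select_mem s w : exists2 k, k \in x0 :: s & select s w = A k w + B k w.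
Proof.
elim: s => [|k s [j js IH]]; first by exists x0; rewrite ?mem_head.
rewrite /= !indicE in_setC; case: (w \in _); rewrite ?mul1r ?mul0r ?addr0 ?add0r.
  by exists k => //; rewrite !inE eqxx orbT.
by exists j => //; move: js; rewrite !inE => /orP[->//|->]; rewrite !orbT.
Qed.

Lemma event_meas_on V k : meas_on Z V (B k) -> <<s cylinder Z V >> [set w | t < B k w].
Proof.
move=> mB; rewrite [X in _ X](_ : _ = B k @^-1` `]t, +oo[%classic).
  exact: meas_on_preimage.
by apply/seteqP; split => w; rewrite /= in_itv /= andbT.
Qed.

Lemma meas_on_indic V E : <<s cylinder Z V >> E -> meas_on Z V (\1_E : Omega -> R).
Proof.
by move=> sE; apply: (@measurable_indic _ (g_sigma_algebraType (cylinder Z V)) R setT E).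
Qed.

Lemma meas_on_select V s : (forall k, k \in x0 :: s -> meas_on Z V (A k)) ->
  (forall k, k \in x0 :: s -> meas_on Z V (B k)) -> meas_on Z V (select s).
Proof.
elim: s => [|k s IH] mA mB /=.
  by apply: measurable_funD; [apply: mA|apply: mB]; rewrite mem_head.
have ks : k \in x0 :: k :: s by rewrite !inE eqxx orbT.
have sub j : j \in x0 :: s -> j \in x0 :: k :: s.
  by rewrite !inE => /orP[->//|->]; rewrite !orbT.
apply: measurable_funD; apply: measurable_funM.
- by apply: meas_on_indic; apply: event_meas_on; exact: mB.
- by apply: measurable_funD; [exact: mA|exact: mB].
- apply: meas_on_indic.
  apply: (@measurableC _ (g_sigma_algebraType (cylinder Z V))).
  by apply: event_meas_on; exact: mB.
- by apply: IH => j /sub; [exact: mA|exact: mB].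
Qed.

(** The first test only looks at the variables indexed by [S k], which A k and
    all other candidates avoid: it is independent of what they bring.  If it
    succeeds, a mean of at least [q + t] is collected; if it fails, induction
    applies to the rest of the list.  All tests fail with probability at most
    (1 - p)^(size s), and B x0 has mean 0, so that [q] is left in this case. *)
Lemma select_mean_ge s : 0 <= t -> uniq (x0 :: s) ->
  (forall k, k \in x0 :: s ->
     meas_on Z (S k) (B k) /\ meas_on Z (~` S k) (A k)) ->
  (forall k, k \in x0 :: s ->
     [/\ P.-integrable setT (EFin \o A k), P.-integrable setT (EFin \o B k),
         q <= \int[P]_w A k w & \int[P]_w B k w = 0]) ->
  (forall j k, j \in x0 :: s -> k \in x0 :: s -> j != k ->
     meas_on Z (~` S k) (A j) /\ meas_on Z (~` S k) (B j)) ->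
  (forall k, k \in s -> p <= fine (P [set w | t < B k w])) ->
  P.-integrable setT (EFin \o select s) /\
  q + t * (1 - (1 - p) ^+ size s) <= \int[P]_w select s w.
Proof.
move=> t0; elim: s => [_ _ h _ _|k s IH us hm h hjk hp].
  have [iA iB qA B0] := h x0 (mem_head _ _).
  split; first exact: (integrableD measurableT iA iB).
  by rewrite /= RintegralD// B0 subrr mulr0 !addr0.
have ks : k \in x0 :: k :: s by rewrite !inE eqxx orbT.
have sub j : j \in x0 :: s -> j \in x0 :: k :: s.
  by rewrite !inE => /orP[->//|->]; rewrite !orbT.
have kNs : k \notin x0 :: s.
  move: us => /= /andP[]; rewrite !inE !negb_or eq_sym => /andP[-> _] /andP[-> _].
  by [].
have us' : uniq (x0 :: s).
  by move: us; rewrite /= inE negb_or -andbA => /and4P[_ -> _ ->].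
have [iW EW] : P.-integrable setT (EFin \o select s) /\
    q + t * (1 - (1 - p) ^+ size s) <= \int[P]_w select s w.
  apply: IH => //.
  - by move=> j /sub; exact: hm.
  - by move=> j /sub; exact: h.
  - by move=> i j /sub ? /sub; exact: hjk.
  - by move=> j js; apply: hp; rewrite inE js orbT.
have [mB mA] := hm k ks; have [iA iB qA B0] := h k ks.
set E := [set w | t < B k w].
have sE : <<s cylinder Z (S k) >> E by exact: event_meas_on.
have sEC : <<s cylinder Z (S k) >> (~` E).
  exact: (@measurableC _ (g_sigma_algebraType (cylinder Z (S k)))).
have mE : measurable E by exact: sigma_cylinder_measurable sE.
have mEC : measurable (~` E) by exact: measurableC.
have mW : meas_on Z (~` S k) (select s).
  apply: meas_on_select => j js; have jk : j != k by apply: contraNneq kNs => <-.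
    by case: (hjk j k (sub j js) ks jk).
  by case: (hjk j k (sub j js) ks jk).
have i1 := integrable_event mE iA.
have i2 := integrable_event mE iB.
have i3 := integrable_event mEC iW.
have i12 := integrableD measurableT i1 i2.
have selE w : select (k :: s) w = (\1_E w * A k w + \1_E w * B k w) + \1_(~` E) w * select s w.
  by rewrite /= mulrDr.
split.
  apply: eq_integrable (integrableD measurableT i12 i3) => // w _.
  by rewrite /= -/E mulrDr.
under eq_Rintegral do rewrite selE.
rewrite RintegralD// RintegralD//.
have SS : S k `&` ~` S k = set0 by rewrite setICr.
rewrite (indep_integral_event indZ SS sE mA iA).
rewrite (indep_integral_event indZ SS sEC mW iW).
set pk := fine (P E).
have pkC : fine (P (~` E)) = 1 - pk.
  by rewrite probability_setC// fineB ?fin_num_measure.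
rewrite pkC.
have pk1 : pk <= 1.
  by rewrite -lee_fin fineK ?fin_num_measure// probability_le1.
have ppk : p <= pk by apply: hp; rewrite mem_head.
have pk0 : 0 <= pk by rewrite fine_ge0.
have EB : t * pk <= \int[P]_w (\1_E w * B k w).
  have iE : P.-integrable setT (EFin \o (\1_E : Omega -> R)).
    exact: integrable_indic.
  have -> : pk = \int[P]_w (\1_E w).
    by rewrite /Rintegral integral_indic// setIT.
  rewrite -RintegralZl//; apply: le_Rintegral => //.
    exact: (integrableZl measurableT t iE).
  move=> w _; rewrite indicE; case: (boolP (w \in E)) => wE; rewrite ?mulr0 ?mul0r//.
  by rewrite mulr1 mul1r; move: wE; rewrite inE => /ltW.
have p1 : 0 <= 1 - p by lra.
rewrite /= exprS; set r := (1 - p) ^+ size s in EW *.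
have r0 : 0 <= r by rewrite exprn_ge0.
have h1 : pk * q <= pk * \int[P]_w A k w by rewrite ler_wpM2l.
have h2 : (1 - pk) * (q + t * (1 - r)) <= (1 - pk) * \int[P]_w select s w.
  by rewrite ler_wpM2l// subr_ge0.
have h3 : t * r * (1 - pk) <= t * r * (1 - p).
  by rewrite ler_wpM2l ?mulr_ge0//; lra.
nra.
Qed.

End selection.
End lincomb.

(** * Parents and descendants in a rooted tree *)

Section tree.
Variable T : rooted_tree.
Local Open Scope nat_scope.
Implicit Types u v w x y : T.

Lemma dist_walk u v : exists2 p, walk (@adj T) u v p & size p = dist u v.
Proof. by rewrite /dist; case: ex_minnP => n /asboolP. Qed.

Lemma dist_le u v p : walk (@adj T) u v p -> dist u v <= size p.
Proof.
by move=> uvp; rewrite /dist; case: ex_minnP => n _; apply; apply/asboolP; exists p.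
Qed.

Lemma height_root : height (Defs.root T) = 0.
Proof. by apply/eqP; rewrite -leqn0 (@dist_le _ _ [::])// /walk /= eqxx. Qed.

Lemma height_eq0 v : height v = 0 -> v = Defs.root T.
Proof.
move=> h; have [p /andP[_ /eqP lp]] := dist_walk (Defs.root T) v.
by rewrite -/(height v) h => /size0nil pE; rewrite -lp pE.
Qed.

Lemma adj_height u v : adj u v -> height v <= (height u).+1.
Proof.
move=> uv; have [p /andP[up /eqP lu] sp] := dist_walk (Defs.root T) u.
rewrite -(sp : _ = height u) -(size_rcons p v) dist_le// /walk rcons_path up last_rcons eqxx lu uv.
by [].
Qed.

(** A vertex met by a geodesic before its end is lower than the end. *)
Lemma notin_low_geodesic v x p : walk (@adj T) (Defs.root T) x p -> size p = height x ->
  height x <= height v -> x != v -> v \notin Defs.root T :: p.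
Proof.
move=> /andP[pp /eqP lx] sp xv; apply: contraNN => /splitPl vp.
move: pp lx sp; case: vp => p1 p2 lv; rewrite cat_path last_cat size_cat lv.
move=> /andP[pp1 _] lx sp.
have : height v <= size p1 by apply: dist_le; rewrite /walk pp1 lv eqxx.
by case: p2 lx sp => [/= -> //|y p2 _ /=]; lia.
Qed.

(** Otherwise the geodesics from the root to [x] and to [y], which avoid [v],
    contain a simple path from [x] to [y] that closes up through [v] to a cycle
    of length at least three. *)
Lemma low_neighbour_unique v x y : adj v x -> adj v y ->
  height x <= height v -> height y <= height v -> x = y.
Proof.
move=> vx vy hx hy; apply/eqP/negP => /negP xy.
have [px wx sx] := dist_walk (Defs.root T) x; have [py wy sy] := dist_walk (Defs.root T) y.
have xv : x != v by apply: contraTneq vx => ->; rewrite adj_irrefl.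
have yv : y != v by apply: contraTneq vy => ->; rewrite adj_irrefl.
have vpx := notin_low_geodesic wx sx hx xv.
have vpy := notin_low_geodesic wy sy hy yv.
move: wx wy => /andP[ppx /eqP lx] /andP[ppy /eqP ly].
(* The walk from x to y through the root. *)
pose q := rev (belast (Defs.root T) px) ++ py.
have lq : last x (rev (belast (Defs.root T) px)) = Defs.root T.
  by rewrite -lx; case: (px) => [//|z p /=]; rewrite rev_cons last_rcons.
have pq : path (@adj T) x q.
  rewrite cat_path lq ppy andbT -lx rev_path.
  by under eq_path do rewrite adj_sym.
have lxq : last x q = y by rewrite last_cat lq.
have vq : v \notin q.
  rewrite mem_cat mem_rev negb_or; apply/andP; split.
    by apply: contra vpx; exact: mem_belast.
  by apply: contra vpy => vp; rewrite inE vp orbT.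
move: lxq; case: (shortenP pq) => p' pp' up' sub ly'.
have := @adj_acyclic T (v :: x :: p').
rewrite /ucycle /= rcons_path pp' vx ly' adj_sym vy /= -[_ && uniq _]/(uniq (x :: p')) up'.
rewrite inE negb_or eq_sym xv /= andbT => /(_ _).
case: p' ly' {up' pp'} sub => [/= xy'|z p' _ sub]; first by rewrite xy' eqxx in xy.
suff -> : v \notin z :: p' by move=> /(_ isT).
by apply: contra vq; exact: sub.
Qed.

(** The default value makes the root its own parent. *)
Definition parent v : T := xget v [set u | adj u v /\ height u < height v].

Lemma parentP v : 0 < height v ->
  adj (parent v) v /\ (height (parent v)).+1 = height v.
Proof.
move=> hv.
have [u uv] : exists u, [set u | adj u v /\ height u < height v] u.
  have [p /andP[pp /eqP lv] sp] := dist_walk (Defs.root T) v.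
  case/lastP: p pp lv sp => [_ _ /= h|p z]; first by rewrite /height -h in hv.
  rewrite rcons_path last_rcons size_rcons => /andP[pp zl] zv sp.
  exists (last (Defs.root T) p); split; first by rewrite -zv.
  rewrite [X in _ < X]/height -sp ltnS; apply: dist_le.
  by rewrite /walk pp eqxx.
have [h1 h2] : adj (parent v) v /\ height (parent v) < height v.
  rewrite /parent; case: xgetP => [y -> //|/(_ u)]; last by case.
split => //; have := adj_height h1; lia.
Qed.

Lemma parent_root : parent (Defs.root T) = Defs.root T.
Proof.
rewrite /parent; case: xgetP => [y _ [_]|//]; by rewrite height_root ltn0.
Qed.

Lemma height_parent v : height (parent v) = (height v).-1.
Proof.
case: (posnP (height v)) => h; last by have [_ <-] := parentP h.
by rewrite (height_eq0 h) parent_root height_root.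
Qed.

Lemma height_iter_parent n v : height (iter n parent v) = height v - n.
Proof. by elim: n => [|n IH]; rewrite ?subn0// iterS height_parent IH; lia. Qed.

Lemma adj_parent u v : adj u v -> height u <= height v -> parent v = u.
Proof.
move=> uv huv; have hv : 0 < height v.
  rewrite lt0n; apply/eqP => h; move: huv; rewrite h leqn0 => /eqP hu.
  by move: uv; rewrite (height_eq0 h) (height_eq0 hu) adj_irrefl.
have [pv hp] := parentP hv.
by apply: (@low_neighbour_unique v); rewrite // 1?adj_sym// -hp.
Qed.

Lemma geodesic_iter_parent p v u : walk (@adj T) (Defs.root T) v p ->
  size p = height v -> u \in Defs.root T :: p -> exists2 n, n <= height v & u = iter n parent v.
Proof.
elim/last_ind: p v u => [|p z IH] v u.
  by move=> /andP[_ /eqP/= <-] _; rewrite inE => /eqP ->; exists 0.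
rewrite /walk rcons_path last_rcons size_rcons => /andP[/andP[pp lz] /eqP zv] sp.
subst z; set y := last _ p in lz.
have wy : walk (@adj T) (Defs.root T) y p by rewrite /walk pp eqxx.
have hy : size p = height y.
  apply/eqP; rewrite eqn_leq dist_le// andbT.
  by have := adj_height lz; rewrite -sp ltnS.
have py : parent v = y by apply: adj_parent => //; rewrite -hy -sp.
rewrite -rcons_cons mem_rcons inE => /orP[/eqP ->|/(IH _ _ wy hy)[n nh ->]].
  by exists 0.
by exists n.+1; [rewrite -sp ltnS hy|rewrite iterSr py].
Qed.

Lemma exists_geodesic v : exists p, [/\ walk (@adj T) (Defs.root T) v p, size p = height v &
  forall n, iter n parent v \in Defs.root T :: p].
Proof.
have [h hE] : exists h, height v = h by exists (height v).
elim: h v hE => [|h IH] v hE.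
  exists [::]; rewrite (height_eq0 hE) height_root /walk /= eqxx; split => // n.
  by elim: n => [|n]; rewrite ?mem_head// iterS !inE => /eqP ->; rewrite parent_root.
have [pv hp] : adj (parent v) v /\ (height (parent v)).+1 = height v.
  by apply: parentP; rewrite hE.
have [p [/andP[pp /eqP lp] sp mp]] := IH (parent v) ltac:(lia).
exists (rcons p v); rewrite /walk rcons_path pp lp pv last_rcons eqxx size_rcons sp hp.
split => // -[|n]; first by rewrite -rcons_cons mem_rcons mem_head.
by rewrite iterSr -rcons_cons mem_rcons inE mp orbT.
Qed.

Lemma tree_leP u v : tree_le u v <-> exists2 n, n <= height v & u = iter n parent v.
Proof.
split => [[p /andP[wp /eqP sp] up]|[n nh ->]].
  exact: (geodesic_iter_parent wp sp up).
have [p [wp sp mp]] := exists_geodesic v.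
by exists p => //; rewrite /geodesic wp sp eqxx.
Qed.

Lemma childrenE v : children v = [set u | parent u = v /\ height u = (height v).+1].
Proof.
apply/seteqP; split => u /=.
  move=> [/tree_leP[n nh vE] d1].
  have vu : adj v u.
    have [p /andP[pp /eqP lp]] := dist_walk u v; rewrite d1 adj_sym.
    by move: pp lp; case: p => [|x [|y q]]//=; rewrite andbT => vx <-.
  have pu : parent u = v.
    by apply: adj_parent => //; rewrite vE height_iter_parent leq_subr.
  split => //; have hu : 0 < height u.
    rewrite lt0n; apply/eqP => h; move: vu.
    by rewrite -pu (height_eq0 h) parent_root adj_irrefl.
  by have [_] := parentP hu; rewrite pu.
move=> [pu hu]; have hu0 : 0 < height u by rewrite hu.
have [vu _] := parentP hu0; rewrite pu in vu.
split; first by apply/tree_leP; exists 1.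
apply/eqP; rewrite eqn_leq; apply/andP; split.
  by rewrite (@dist_le _ _ [:: v])// /walk /= adj_sym vu eqxx.
rewrite lt0n; apply/eqP => d0; have [p /andP[_ /eqP lp]] := dist_walk u v.
rewrite d0 => /size0nil pE; rewrite pE /= in lp.
by rewrite lp adj_irrefl in vu.
Qed.

Hypothesis lf : @locally_finite T.

Lemma finite_children v : finite_set (children v).
Proof.
apply: sub_finite_set (lf v) => u; rewrite childrenE /= => -[pu hu].
by have [] : adj (parent u) u /\ _ := @parentP u ltac:(lia); rewrite pu.
Qed.

Definition child_seq v : seq T := fset_set (children v).

Lemma mem_child_seq v u : (u \in child_seq v) = (parent u == v) && (height u == (height v).+1).
Proof.
rewrite /child_seq in_fset_set; last exact: finite_children.
rewrite childrenE; apply/idP/idP => [|/andP[/eqP pu /eqP hu]]; last by rewrite inE.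
by rewrite inE => -[-> ->]; rewrite !eqxx.
Qed.

Fixpoint descendants (m : nat) (u : T) : seq T :=
  if m is m'.+1 then flatten [seq child_seq x | x <- descendants m' u] else [:: u].

Lemma mem_descendants m u x :
  (x \in descendants m u) = (iter m parent x == u) && (height x == height u + m).
Proof.
elim: m u x => [|m IH] u x.
  by rewrite /= inE addn0; case: eqP => [->|]; rewrite ?eqxx.
rewrite /=; apply/flattenP/andP => [[s /mapP[y]]|[/eqP xu /eqP hx]].
  rewrite IH => /andP[/eqP yu /eqP hy] ->; rewrite mem_child_seq => /andP[/eqP xy /eqP hx].
  by rewrite -iterS iterSr xy yu hx hy addnS !eqxx.
exists (child_seq (parent x)); last first.
  by rewrite mem_child_seq eqxx /= height_parent hx addnS.
apply/mapP; exists (parent x) => //.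
by rewrite IH -iterSr iterS xu height_parent hx addnS /= !eqxx.
Qed.

Lemma descendants_uniq m u : uniq (descendants m u).
Proof.
elim: m => [//|m IH] /=.
elim: (descendants m u) IH => [//|x s IHs] /= /andP[xs us].
rewrite cat_uniq fset_uniq IHs// andbT /=; apply/hasPn => y /flattenP[s' /mapP[z zs ->]].
rewrite !mem_child_seq => /andP[/eqP pz _]; rewrite negb_and pz; apply/orP; left.
by apply: contraNneq xs => <-.
Qed.

Variable R : realType.

Lemma size_descendants_ge (r : R) m u : (0 <= r)%R ->
  (forall v, r <= (nb_children v)%:R)%R -> (r ^+ m <= (size (descendants m u))%:R)%R.
Proof.
move=> r0 hr; elim: m => [|m IH] /=; first by rewrite expr0.
have h (s : seq T) : (r * (size s)%:R <= (size (flatten [seq child_seq x | x <- s]))%:R)%R.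
  elim: s => [|x s IHs] /=; first by rewrite mulr0.
  by rewrite size_cat natrD -natr1 mulrDr mulr1 addrC lerD// hr.
by apply: le_trans (h _); rewrite exprS ler_wpM2l.
Qed.

Lemma size_descendants_le (r : R) m u : (0 <= r)%R ->
  (forall v, (nb_children v)%:R <= r)%R -> ((size (descendants m u))%:R <= r ^+ m)%R.
Proof.
move=> r0 hr; elim: m => [|m IH] /=; first by rewrite expr0.
have h (s : seq T) : ((size (flatten [seq child_seq x | x <- s]))%:R <= r * (size s)%:R)%R.
  elim: s => [|x s IHs] /=; first by rewrite mulr0.
  by rewrite size_cat natrD -natr1 mulrDr mulr1 addrC lerD// hr.
by apply: le_trans (h _) _; rewrite exprS ler_wpM2l.
Qed.

End tree.

(** * The functional Q and the dyadic blocks *)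

Section dyadic.
Variables (R : realType) (al : nat -> R).
Implicit Types (k l b j : nat) (L : nat).

Definition blockvar b : R := \sum_(2 ^ b <= k < 2 ^ b.+1) al k ^+ 2.
Definition tailvar L l : R := \sum_(l.+1 <= k < L) al k ^+ 2.
Definition Qsum L : R := \sum_(0 <= l < L) Num.sqrt (l.+1%:R^-1 * tailvar L l).
Definition blocksum K : R := \sum_(0 <= b < K) Num.sqrt (2 ^+ b * blockvar b).

Lemma sum_sqr_ge0 m n : 0 <= \sum_(m <= k < n) al k ^+ 2 :> R.
Proof. by rewrite sumr_ge0// => k _; exact: sqr_ge0. Qed.

Lemma sum_sqr_le m m' n n' : (m' <= m)%N -> (n <= n')%N ->
  \sum_(m <= k < n) al k ^+ 2 <= \sum_(m' <= k < n') al k ^+ 2 :> R.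
Proof.
move=> mm nn; case: (leqP n m) => nm.
  by rewrite big_geq// sum_sqr_ge0.
have mn := ltnW nm.
rewrite (big_cat_nat (n := m) (p := n'))//=; last exact: leq_trans nn.
rewrite (big_cat_nat (n := n) (m := m) (p := n'))//=.
by rewrite addrCA lerDl addr_ge0// sum_sqr_ge0.
Qed.

Lemma blockvar_ge0 b : 0 <= blockvar b. Proof. exact: sum_sqr_ge0. Qed.

(** The 2^j terms 2^j <= l < 2^(j+1) of Q are each at least the square root of
    blockvar (j+1) / 2^(j+1). *)
Lemma blocksum_le_Qsum_aux L j : (2 ^ j.+1 <= L)%N ->
  blocksum j.+1 <= 2 * \sum_(0 <= l < 2 ^ j) Num.sqrt (l.+1%:R^-1 * tailvar L l).
Proof.
elim: j => [|j IH] jL.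
  rewrite expn0 /blocksum !big_nat1 expr0 mul1r invr1 mul1r.
  apply: (@le_trans _ _ (Num.sqrt (tailvar L 0))).
    by rewrite ler_wsqrtr// sum_sqr_le.
  by rewrite ler_peMl ?sqrtr_ge0// ler1n.
rewrite /blocksum big_nat_recr//= (big_cat_nat (n := (2 ^ j)%N) (m := 0%N) (p := (2 ^ j.+1)%N))//=; last first.
  by rewrite leq_pexp2l.
rewrite mulrDr lerD//; first by apply: IH; apply: leq_trans jL; rewrite leq_pexp2l.
set V := blockvar j.+1.
pose q := Num.sqrt ((2 ^+ j.+1)^-1 * V).
have : \sum_(2 ^ j <= l < 2 ^ j.+1) q <=
       \sum_(2 ^ j <= l < 2 ^ j.+1) Num.sqrt (l.+1%:R^-1 * tailvar L l).
  rewrite !big_nat ler_sum// => l /andP[l1 l2].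
  rewrite ler_wsqrtr// ler_pM ?invr_ge0 ?exprn_ge0 ?sum_sqr_ge0//.
    rewrite lef_pV2 ?posrE ?exprn_gt0 ?ltr0n//.
    by rewrite -natrX ler_nat.
  by rewrite sum_sqr_le.
rewrite sumr_const_nat.
have -> : (2 ^ j.+1 - 2 ^ j)%N = (2 ^ j)%N by rewrite expnS; lia.
have P0 : 0 < 2 ^+ j.+1 :> R by rewrite exprn_gt0.
have -> : Num.sqrt (2 ^+ j.+1 * V) = 2 * (q *+ 2 ^ j).
  rewrite -[q *+ _]mulr_natl mulrA -natrM -expnS natrX.
  have -> : 2 ^+ j.+1 * V = (2 ^+ j.+1) ^+ 2 * ((2 ^+ j.+1)^-1 * V).
    by field; rewrite gt_eqF.
  by rewrite sqrtrM ?sqr_ge0// sqrtr_sqr gtr0_norm.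
by rewrite ler_pM2l.
Qed.

Lemma blocksum_le_Qsum K : blocksum K <= 2 * Qsum (2 ^ K).
Proof.
have term0 L l : 0 <= Num.sqrt (l.+1%:R^-1 * tailvar L l) by exact: sqrtr_ge0.
case: K => [|K].
  by rewrite /blocksum big_geq// mulr_ge0// sumr_ge0.
apply: le_trans (blocksum_le_Qsum_aux (leqnn _)) _.
rewrite ler_pM2l// /Qsum [leRHS](big_cat_nat (n := (2 ^ K)%N))//=.
  by rewrite lerDl sumr_ge0.
by rewrite leq_pexp2l.
Qed.

Lemma sqrtrD_le (x y : R) : 0 <= x -> 0 <= y ->
  Num.sqrt (x + y) <= Num.sqrt x + Num.sqrt y.
Proof.
move=> x0 y0; rewrite -ler_sqr ?nnegrE ?addr_ge0 ?sqrtr_ge0//.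
rewrite sqr_sqrtr ?addr_ge0// sqrrD !sqr_sqrtr//.
have := mulr_ge0 (sqrtr_ge0 x) (sqrtr_ge0 y); lra.
Qed.

(** Comparison with the increments of 2 sqrt n. *)
Lemma sum_invsqrt_le n :
  \sum_(0 <= l < n) Num.sqrt (l.+1%:R^-1) <= 2 * Num.sqrt n%:R :> R.
Proof.
elim: n => [|n IH]; first by rewrite big_geq// sqrtr0 mulr0.
rewrite big_nat_recr//=; apply: le_trans (lerD IH (lexx _)) _.
set a := Num.sqrt n%:R; set c := Num.sqrt n.+1%:R.
have a0 : 0 <= a by exact: sqrtr_ge0.
have c0 : 0 < c by rewrite sqrtr_gt0 ltr0n.
have a2 : a ^+ 2 = n%:R by rewrite sqr_sqrtr.
have c2 : c ^+ 2 = n%:R + 1 by rewrite sqr_sqrtr// natr1.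
rewrite sqrtrV ?ler0n// -/c.
rewrite -(ler_pM2r c0) mulrDl mulVf ?gt_eqF//.
nra.
Qed.

Lemma tailvarS K l : tailvar (2 ^ K.+1) l <= tailvar (2 ^ K) l + blockvar K.
Proof.
rewrite /tailvar /blockvar; case: (leqP l.+1 (2 ^ K)) => lK.
  by rewrite -(big_cat_nat (n := (2 ^ K)%N) (m := l.+1))//= leq_pexp2l.
by rewrite [X in X + _]big_geq ?(ltnW lK)// add0r sum_sqr_le// ltnW.
Qed.

(** By induction on [K]: the last block adds at most sqrt (blockvar K) /
    sqrt (l+1) to the term of index l, and these sum up to at most
    2 sqrt (2^(K+1) * blockvar K). *)
Lemma Qsum_le_blocksum K : Qsum (2 ^ K) <= 3 * blocksum K.
Proof.
elim: K => [|K IH].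
  rewrite /Qsum expn0 big_nat1 /tailvar /blocksum !big_geq// !mulr0 sqrtr0.
  exact: lexx.
rewrite /Qsum.
apply: (@le_trans _ _ (\sum_(0 <= l < 2 ^ K.+1)
    (Num.sqrt (l.+1%:R^-1 * tailvar (2 ^ K) l) +
     Num.sqrt (blockvar K) * Num.sqrt (l.+1%:R^-1)))).
  apply: ler_sum => l _; have l0 : 0 <= l.+1%:R^-1 :> R by rewrite invr_ge0.
  have h1 := sum_sqr_ge0; have h2 := blockvar_ge0 K.
  rewrite [in X in _ + X]mulrC -sqrtrM//.
  apply: le_trans (sqrtrD_le _ _); rewrite ?mulr_ge0 ?sum_sqr_ge0//.
  by rewrite ler_wsqrtr// -mulrDr ler_wpM2l// tailvarS.
rewrite big_split/= -mulr_sumr.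
have -> : \sum_(0 <= l < 2 ^ K.+1) Num.sqrt (l.+1%:R^-1 * tailvar (2 ^ K) l) = Qsum (2 ^ K).
  rewrite (big_cat_nat (n := (2 ^ K)%N))//=; last by rewrite leq_pexp2l.
  rewrite [X in _ + X]big_nat [X in _ + X]big1 ?addr0// => l /andP[l1 _].
  by rewrite /tailvar big_geq ?mulr0 ?sqrtr0// ltnW.
rewrite /blocksum big_nat_recr//= mulrDr lerD//.
have v0 := sqrtr_ge0 (blockvar K).
apply: le_trans (ler_wpM2l v0 (sum_invsqrt_le _)) _.
rewrite natrX exprS !sqrtrM ?exprn_ge0// mulrCA !mulrA.
have s2 : Num.sqrt 2 <= 3 / 2 :> R.
  rewrite -ler_sqr ?nnegrE ?sqrtr_ge0// sqr_sqrtr//; lra.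
have := mulr_ge0 v0 (sqrtr_ge0 (2 ^+ K)).
set x := Num.sqrt (blockvar K); set y := Num.sqrt (2 ^+ K) => xy.
have -> : 2 * x * Num.sqrt 2 * y = x * y * (2 * Num.sqrt 2) by ring.
have -> : 3 * y * x = x * y * 3 by ring.
by rewrite ler_wpM2l//; lra.
Qed.

End dyadic.

Section Q_finite.
Variables (R : realType) (N : nat) (a : N.-tuple R).

Lemma extend0 : extend a 0 = 0. Proof. by []. Qed.

Lemma extend_gt k : (N < k)%N -> extend a k = 0.
Proof. by move=> Nk; rewrite /extend nth_default//= size_tuple. Qed.

Lemma Q_extend L : (N < L)%N -> Q (extend a) = (Qsum (extend a) L)%:E.
Proof.
move=> NL; rewrite /Q.
have tailE l : (\sum_(l.+1 <= k <oo) (extend a k ^+ 2)%:E = (tailvar (extend a) L l)%:E)%E.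
  rewrite (nneseries_split _ (L - l.+1)); last by move=> k _; rewrite lee_fin sqr_ge0.
  rewrite (_ : (\sum_(l.+1 + (L - l.+1) <= k <oo) _)%E = 0%E) ?adde0.
    rewrite sumEFin /tailvar; congr EFin.
    case: (leqP l.+1 L) => lL; first by rewrite subnKC.
    by rewrite !big_geq//; lia.
  apply: eseries0 => k Lk _.
  by rewrite extend_gt ?expr0n//; lia.
rewrite (nneseries_split _ L); last by move=> k _; exact: sqrte_ge0.
rewrite (_ : (\sum_(0 + L <= k <oo) _)%E = 0%E) ?adde0.
  rewrite add0n /Qsum -sumEFin; apply: eq_bigr => l _.
  by rewrite tailE -EFinM.
apply: eseries0 => k Lk _.
by rewrite tailE /tailvar big_geq ?mule0 /= ?sqrtr0//; lia.
Qed.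

End Q_finite.

(** * Sums along ancestral lines, and lower bound by a greedy path *)

Section ancestors.
Variable T : rooted_tree.
Implicit Types (u v : T) (k m n : nat).

Definition anc v k : T := iter (height v - k) (@parent T) v.

Lemma height_anc v k : (k <= height v)%N -> height (anc v k) = k.
Proof. by move=> kv; rewrite height_iter_parent subKn. Qed.

Lemma anc_height v : anc v (height v) = v.
Proof. by rewrite /anc subnn. Qed.

Lemma anc_anc v j k : (j <= k)%N -> (k <= height v)%N -> anc (anc v k) j = anc v j.
Proof.
move=> jk kv; rewrite {1}/anc height_anc// /anc -iterD; congr iter; lia.
Qed.

Definition path_seq v m n : seq T := [seq anc v k | k <- index_iota m n].

Lemma path_uniq v m n : (n <= (height v).+1)%N -> uniq (path_seq v m n).
Proof.
move=> nv; rewrite map_inj_in_uniq ?iota_uniq// => j k.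
rewrite !mem_index_iota => /andP[_ jn] /andP[_ kn] jk.
by rewrite -(@height_anc v j) ?jk ?height_anc//; lia.
Qed.

Lemma mem_path_seq v m n u : (n <= (height v).+1)%N ->
  (u \in path_seq v m n) = (m <= height u < n)%N && (u == anc v (height u)).
Proof.
move=> nv; apply/mapP/idP => [[k]|/andP[mn /eqP uE]].
  rewrite mem_index_iota => /andP[mk kn] ->.
  by rewrite height_anc ?mk ?kn ?eqxx//; lia.
by exists (height u); rewrite // mem_index_iota.
Qed.

Lemma anc_path_seq v m n k : (k <= height v)%N -> (n <= k.+1)%N ->
  path_seq (anc v k) m n = path_seq v m n.
Proof.
move=> kv nk; apply/eq_in_map => j; rewrite mem_index_iota => /andP[_ jn].
by rewrite anc_anc//; lia.
Qed.

Variables (R : realType) (al : nat -> R).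

Lemma sum_path_seq v m n (f : T -> R) :
  \sum_(i <- path_seq v m n) f i = \sum_(m <= k < n) f (anc v k).
Proof. by rewrite /path_seq big_map. Qed.

Lemma var_path_seq v m n : (n <= (height v).+1)%N ->
  \sum_(i <- path_seq v m n) al (height i) ^+ 2 = \sum_(m <= k < n) al k ^+ 2.
Proof.
move=> nv; rewrite sum_path_seq; apply: eq_big_nat => k /andP[_ kn].
by rewrite height_anc//; lia.
Qed.

Context (d : measure_display) (Omega : measurableType d)
  (P : probability Omega R) (Z : T -> {RV P >-> R}).

(** The increment of the field between levels [m] and [n] of the ancestral line. *)
Definition path_sum v m n (w : Omega) : R :=
  \sum_(i <- path_seq v m n) al (height i) * Z i w.

Lemma path_sum_cat v m n p w : (m <= n)%N -> (n <= p)%N ->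
  path_sum v m p w = path_sum v m n w + path_sum v n p w.
Proof. by move=> mn np; rewrite /path_sum !sum_path_seq -big_cat_nat. Qed.

Lemma path_sum_eq0 v m n w : (n <= (height v).+1)%N ->
  (forall k, (m <= k < n)%N -> al k = 0) -> path_sum v m n w = 0.
Proof.
move=> nv al0; rewrite /path_sum sum_path_seq big_nat big1// => k kmn.
by rewrite height_anc ?al0 ?mul0r//; lia.
Qed.

Lemma G_path_sum v w : G Z al v w = path_sum v 0 (height v).+1 w.
Proof.
rewrite /G /path_sum (_ : [set u | tree_le u v] = [set` path_seq v 0 (height v).+1]).
  by rewrite -fsbig_seq ?path_uniq.
apply/seteqP; split => u /=.
  move=> /tree_leP[n nv ->]; apply/mapP; exists (height v - n)%N.
    by rewrite mem_index_iota; lia.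
  by rewrite /anc subKn.
move=> /mapP[k]; rewrite mem_index_iota => kv ->; apply/tree_leP.
by exists (height v - k)%N => //; lia.
Qed.

End ancestors.

Section lower.
Variable T : rooted_tree.
Hypothesis lf : @locally_finite T.
Variables (R : realType) (al : nat -> R).
Context (d : measure_display) (Omega : measurableType d)
  (P : probability Omega R) (Z : T -> {RV P >-> R}).
Hypothesis gZ : forall v, standard_gaussian (Z v).
Hypothesis indZ : mutually_independent Z.
Variable r : R.
Hypothesis r2 : 2 <= r.
Hypothesis nbr : forall v : T, r <= (nb_children v)%:R.

Definition strictly_below (u : T) : set T :=
  [set w | (height u < height w)%N /\ anc w (height u) = u].

(** The factor 1/8 is the factor 1/4 of the threshold in the lower tail bound,
    times a loss sqrt m >= sqrt (2^b) / 2 in the number m of branching levels. *)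
Definition gain_const : R := (1 - expR (- (tail_const R / 2))) / 8.

Definition gain b : R := gain_const * Num.sqrt (ln r) * Num.sqrt (2 ^+ b * blockvar al b).

Lemma tail_const_gt0 : 0 < tail_const R.
Proof.
rewrite exprn_gt0// subr_gt0 expR_lt1 oppr_lt0 divr_gt0// ln_gt0// ltr1n.
by [].
Qed.

Lemma tail_const_le1 : tail_const R <= 1.
Proof.
have ln2 : 0 < ln (2 : R) by rewrite ln_gt0// ltr1n.
have e1 : expR (- (ln 2 / 4)) <= 1 :> R by rewrite expR_le1 oppr_le0 divr_ge0// ltW.
by rewrite exprn_ile1// ?subr_ge0// lerBlDr lerDl expR_ge0.
Qed.

Lemma gain_const_gt0 : 0 < gain_const.
Proof.
rewrite divr_gt0// subr_gt0 expR_lt1 oppr_lt0 divr_gt0//.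
exact: tail_const_gt0.
Qed.

Lemma r_ge1 : 1 <= r. Proof. by apply: le_trans r2; rewrite ler1n. Qed.

Lemma gain_ge0 b : 0 <= gain b.
Proof.
apply: mulr_ge0; last exact: sqrtr_ge0.
by apply: mulr_ge0; [exact/ltW/gain_const_gt0|exact: sqrtr_ge0].
Qed.

Lemma gaussian_path_sum v m n : (n <= (height v).+1)%N ->
  gaussian_mgf P (path_sum al Z v m n) (\sum_(m <= k < n) al k ^+ 2).
Proof.
move=> nv; rewrite -(var_path_seq al m nv).
exact: (gaussian_mgf_lincomb gZ indZ (fun i => al (height i)) (path_uniq m nv)).
Qed.

Lemma meas_on_path_sum (J : set T) v m n :
  (forall i, i \in path_seq v m n -> J i) -> meas_on Z J (path_sum al Z v m n).
Proof. exact: meas_on_lincomb. Qed.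

(** With M candidates at least, each accepted with probability at least of
    order 1 / M, the probability that none is accepted stays away from 1. *)
Lemma no_success (M : R) n : 2 <= M -> M <= n.+1%:R ->
  (1 - tail_const R / M) ^+ n <= expR (- (tail_const R / 2)).
Proof.
move=> M2 Mn; set c := tail_const R.
have c0 : 0 < c by exact: tail_const_gt0.
have M0 : 0 < M by apply: lt_le_trans M2.
have cM : c / M <= 1.
  by rewrite ler_pdivrMr// mul1r (le_trans tail_const_le1)// (le_trans _ M2)// ler1n.
apply: (@le_trans _ _ (expR (- (c / M)) ^+ n)).
  by rewrite lerXn2r ?nnegrE ?expR_ge0 ?subr_ge0// expR_ge1Dx.
rewrite -expRM_natl ler_expR mulrN lerN2.
rewrite mulrCA ler_pM2l// ler_pdivlMr// ler_pdivrMl//.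
by move: Mn; rewrite -natr1; lra.
Qed.

(** The constant [q] bounds from below the mean collected from the end of
    block [b] on.  The candidates are the descendants x of [u] at height 2^b,
    each continued to a vertex ext x at the last level of the block.  In the
    notation of [select], B x is the increment over the block, tested
    independently for different x, and A x gathers the increments between [u]
    and x and those below ext x. *)
Lemma lower_step (b : nat) (u : T) (q : R) : ((height u).*2 <= 2 ^ b)%N ->
  (forall v : T, height v = (2 ^ b.+1).-1 -> exists C : Omega -> R,
     [/\ meas_on Z (strictly_below v) C, P.-integrable setT (EFin \o C),
         q <= \int[P]_w C w &
         forall w, exists v', [/\ (height v <= height v')%N, anc v' (height v) = v &
            C w = path_sum al Z v' (height v).+1 (height v').+1 w]]) ->
  exists C : Omega -> R,
     [/\ meas_on Z (strictly_below u) C, P.-integrable setT (EFin \o C),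
         q + gain b <= \int[P]_w C w &
         forall w, exists v', [/\ (height u <= height v')%N, anc v' (height u) = u &
            C w = path_sum al Z v' (height u).+1 (height v').+1 w]].
Proof.
move=> hu IH.
have [X XE] : exists X, X = (2 ^ b)%N by exists (2 ^ b)%N.
have [Y YE] : exists Y, Y.+1 = (2 ^ b.+1)%N.
  by exists (2 ^ b.+1).-1; rewrite prednK// expn_gt0.
have X0 : (0 < X)%N by rewrite XE expn_gt0.
have YX : Y.+1 = (2 * X)%N by rewrite YE XE expnS.
rewrite -XE in hu; rewrite -YE /= in IH.
have XY : (X <= Y)%N by lia.
have uX : (height u < X)%N by lia.
have uY : (height u <= Y)%N by exact: leq_trans (ltnW uX) XY.
pose m := (X - height u)%N.
have mX : (X <= 2 * m)%N by rewrite /m; lia.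
have r0 : 0 <= r by apply: le_trans r_ge1.
have szd k (x : T) : r ^+ k <= (size (descendants k x))%:R by exact: size_descendants_ge.
have rk1 k : 1 <= r ^+ k by rewrite exprn_ege1// r_ge1.
pose ext (x : T) : T := head x (descendants (Y - X) x).
have extP x : height x = X -> height (ext x) = Y /\ anc (ext x) X = x.
  move=> hx; have : ext x \in descendants (Y - X) x.
    have : 0 < (size (descendants (Y - X) x))%:R :> R.
      exact: (lt_le_trans ltr01 (le_trans (rk1 _) (szd _ _))).
    by rewrite ltr0n /ext; case: (descendants _ x) => //= y s _; exact: mem_head.
  rewrite mem_descendants// => /andP[/eqP ax /eqP hex].
  have hY : height (ext x) = Y by rewrite hex hx; lia.
  by rewrite /anc hY.
pose good (v : T) (C : Omega -> R) : Prop :=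
  [/\ meas_on Z (strictly_below v) C, P.-integrable setT (EFin \o C),
      q <= \int[P]_w C w &
      forall w, exists v', [/\ (height v <= height v')%N, anc v' (height v) = v &
        C w = path_sum al Z v' (height v).+1 (height v').+1 w]].
have [C HC] : {C : T -> Omega -> R & forall x, height x = X -> good (ext x) (C x)}.
  apply: (@choice _ _ (fun x C => height x = X -> good (ext x) C)) => x.
  have [hx|nx] := eqVneq (height x) X; last by exists (fun=> 0) => /eqP; rewrite (negPf nx).
  have [hy _] := extP x hx.
  by have [Cx] := IH _ hy; exists Cx.
pose B x := path_sum al Z (ext x) X Y.+1.
pose A x w := path_sum al Z (ext x) (height u).+1 X w + C x w.
pose S x : set T := [set` path_seq (ext x) X Y.+1].
have memd x : x \in descendants m u -> height x = X /\ anc x (height u) = u.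
  rewrite mem_descendants// => /andP[/eqP xu /eqP hx].
  have hX : height x = X by rewrite hx /m subnKC// ltnW.
  by split => //; rewrite /anc hX.
have hS x i : height x = X -> S x i -> [/\ (X <= height i <= Y)%N & anc i X = x].
  move=> hx; have [hy ax] := extP x hx.
  rewrite /S /= mem_path_seq ?hy// => /andP[hi /eqP iE]; split => //.
  by rewrite iE anc_anc ?ax//; lia.
have mS x : height x = X -> meas_on Z (S x) (B x).
  by move=> hx; apply: meas_on_path_sum.
have Cbelow x i : height x = X -> strictly_below (ext x) i -> (Y < height i)%N.
  by move=> /extP[hy _] []; rewrite hy.
have low x i : height x = X -> i \in path_seq (ext x) (height u).+1 X ->
    [/\ (height u < height i)%N, (height i < X)%N & anc i (height u) = anc x (height u)].
  move=> hx; have [hy ax] := extP x hx.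
  rewrite mem_path_seq ?hy; last by lia.
  move=> /andP[hi /eqP iE]; split; [lia|lia|].
  rewrite iE anc_anc; [|lia|lia].
  by transitivity (anc (anc (ext x) X) (height u)); [rewrite anc_anc//; lia|rewrite ax].
have mA x y : height x = X -> height y = X -> meas_on Z (~` S y) (A x).
  move=> hx hy; have [mC _ _ _] := HC x hx.
  apply: measurable_funD.
    by apply: meas_on_path_sum => i /(low x i hx)[_ iX _] /(hS _ _ hy)[]; lia.
  apply: meas_on_sub mC => i /(Cbelow _ _ hx) iY /(hS _ _ hy)[/andP[_ iY'] _].
  by move: iY; rewrite ltnNge iY'.
have mB x y : height x = X -> height y = X -> x != y -> meas_on Z (~` S y) (B x).
  move=> hx hy xy; apply: meas_on_path_sum => i iS /(hS _ _ hy)[_ iy].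
  by have [_ ix] := hS x i hx iS; move: xy; rewrite -ix -iy eqxx.
have gB x : height x = X -> gaussian_mgf P (B x) (blockvar al b).
  move=> hx; have [hy _] := extP x hx.
  rewrite /blockvar -YE -XE.
  by apply: gaussian_path_sum; rewrite hy.
have hA x : height x = X -> P.-integrable setT (EFin \o A x) /\ q <= \int[P]_w A x w.
  move=> hx; have [_ iC qC _] := HC x hx; have [hy _] := extP x hx.
  have gA : gaussian_mgf P (path_sum al Z (ext x) (height u).+1 X)
      (\sum_((height u).+1 <= k < X) al k ^+ 2).
    by apply: gaussian_path_sum; rewrite hy; lia.
  have iA := gaussian_mgf_integrable gA.
  split; first exact: (integrableD measurableT iA iC).
  by rewrite RintegralD// (gaussian_mgf_mean gA) add0r.
have AB x w : height x = X -> exists v', [/\ (height u <= height v')%N,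
     anc v' (height u) = anc x (height u) &
     A x w + B x w = path_sum al Z v' (height u).+1 (height v').+1 w].
  move=> hx; have [_ _ _ Cw] := HC x hx; have [hy ax] := extP x hx.
  have [v' [hv' av' CE]] := Cw w; rewrite hy in hv' av' CE; exists v'.
  split; first by lia.
    transitivity (anc (anc (anc v' Y) X) (height u)); last by rewrite av' ax.
    by rewrite !anc_anc//; rewrite ?height_anc; lia.
  have pE k l : (l <= Y.+1)%N -> path_sum al Z (ext x) k l = path_sum al Z v' k l.
    by move=> lY; rewrite /path_sum -av' anc_path_seq.
  rewrite /A /B CE !pE//; last by lia.
  have Xv : (X <= (height v').+1)%N by lia.
  have Yv : (Y.+1 <= (height v').+1)%N by lia.
  have uX1 : ((height u).+1 <= X)%N by lia.
  have XY1 : (X <= Y.+1)%N by lia.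
  rewrite (path_sum_cat al Z v' w uX1 Xv) (path_sum_cat al Z v' w XY1 Yv).
  by rewrite -addrA (addrC (path_sum _ _ _ Y.+1 _ _)).
have finish x0 ys t p : 0 <= t -> {subset x0 :: ys <= descendants m u} -> uniq (x0 :: ys) ->
    (forall k, k \in ys -> p <= fine (P [set w | t < B k w])) ->
    gain b <= t * (1 - (1 - p) ^+ size ys) ->
    exists C : Omega -> R,
     [/\ meas_on Z (strictly_below u) C, P.-integrable setT (EFin \o C),
         q + gain b <= \int[P]_w C w &
         forall w, exists v', [/\ (height u <= height v')%N, anc v' (height u) = u &
            C w = path_sum al Z v' (height u).+1 (height v').+1 w]].
  move=> t0 sub us pP gt.
  have hX k : k \in x0 :: ys -> height k = X by move=> /sub/memd[].
  have [iW EW] : P.-integrable setT (EFin \o select A B x0 t ys) /\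
      q + t * (1 - (1 - p) ^+ size ys) <= \int[P]_w select A B x0 t ys w.
    apply: (@select_mean_ge _ _ _ _ _ Z indZ _ S) => //.
    - by move=> k /hX kX; split; [exact: mS|exact: mA].
    - move=> k /hX kX; have [iA qA] := hA k kX; have gBk := gB k kX.
      by split => //; [exact: gaussian_mgf_integrable gBk|exact: gaussian_mgf_mean gBk].
    - by move=> j k /hX jX /hX kX jk; split; [exact: mA|exact: mB].
  exists (select A B x0 t ys); split => //.
  - apply: meas_on_select => k kys; have [kX ku] := memd k (sub k kys); have [hk ak] := extP k kX.
      have [mC _ _ _] := HC k kX; apply: measurable_funD.
        by apply: meas_on_path_sum => i /(low k i kX)[h1 _ h2]; split => //; rewrite h2.
      apply: meas_on_sub mC => i [h1 h2]; rewrite hk in h1 h2.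
      split; first exact: leq_ltn_trans uY h1.
      rewrite -(anc_anc uY (ltnW h1)) h2.
      by rewrite -(@anc_anc _ (ext k) (height u) X (ltnW uX)) ?hk// ak.
    apply: meas_on_path_sum => i iS; have [/andP[h1 _] h2] := hS k i kX iS.
    split; first exact: leq_trans uX h1.
    by rewrite -(anc_anc (ltnW uX) h1) h2.
  - by apply: le_trans EW; rewrite lerD2l.
  - move=> w; have [k kys ->] := select_mem A B x0 t ys w.
    have [kX ku] := memd k (sub k kys).
    by have [v' [h1 h2 h3]] := AB k w kX; exists v'; rewrite h2 ku.
have sz := szd m u.
have [x0 [xs sE]] : exists x0 xs, descendants m u = x0 :: xs.
  case E : (descendants m u) => [|x0 xs]; last by exists x0, xs.
  by move: sz; rewrite E leNgt (lt_le_trans ltr01 (rk1 _)).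
have us := descendants_uniq lf m u; rewrite sE in us sz finish.
(* A block of variance 0 brings nothing: any single candidate will do. *)
have [bv0|bv0] := eqVneq (blockvar al b) 0.
  apply: (finish x0 [::] 0 0) => //; first by move=> k; rewrite !inE => ->.
  by rewrite /gain bv0 mulr0 sqrtr0 mulr0 mul0r.
have bv1 : 0 < blockvar al b by rewrite lt_neqAle eq_sym bv0 blockvar_ge0.
have m1 : (1 <= m)%N by rewrite subn_gt0.
(* M is a lower bound on the number of candidates, and s^2 = ln M makes the
   tail bound at level s of order 1 / M. *)
pose M := r ^+ m.
have M2 : 2 <= M by apply: le_trans r2 _; rewrite -[leLHS]expr1; apply: ler_weXn2l m1; exact: r_ge1.
have M0 : 0 < M by apply: lt_le_trans M2.
have lnM : ln M = m%:R * ln r.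
  by rewrite lnXn ?mulr_natl//; apply: lt_le_trans r_ge1.
have lM2 : ln 2 <= ln M by rewrite ler_ln// posrE.
have ln20 : 0 < ln (2 : R) by rewrite ln_gt0// ltr1n.
pose s := Num.sqrt (ln M).
have s2 : s ^+ 2 = ln M by rewrite sqr_sqrtr// ltW// (lt_le_trans ln20).
have s0 : 0 < s by rewrite sqrtr_gt0 (lt_le_trans ln20).
pose t := Num.sqrt (blockvar al b) * s / 4.
have t0 : 0 <= t by rewrite divr_ge0// mulr_ge0 ?sqrtr_ge0// ltW.
pose p := tail_const R / M.
have pP k : k \in xs -> p <= fine (P [set w | t < B k w]).
  move=> kxs; have [kX _] : height k = X /\ anc k (height u) = u.
    by apply: memd; rewrite sE inE kxs orbT.
  have := gaussian_mgf_tail (gB k kX) bv1 s0.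
  rewrite s2 => /(_ lM2); rewrite /p; congr (_ <= _); congr (_ * _).
  by rewrite expRN lnK// posrE.
apply: (finish x0 xs t p) => //.
have Mn : M <= (size xs).+1%:R by exact: sz.
have := no_success M2 Mn; rewrite -/p; set z := (1 - p) ^+ size xs => zle.
have mlr : s = Num.sqrt m%:R * Num.sqrt (ln r) by rewrite /s lnM sqrtrM.
have hb : Num.sqrt (2 ^+ b) <= 2 * Num.sqrt m%:R :> R.
  have -> : 2 * Num.sqrt m%:R = Num.sqrt (4 * m%:R) :> R.
    rewrite sqrtrM// (_ : 4 = 2 ^+ 2 :> R); last by rewrite expr2 -natrM.
    by rewrite sqrtr_sqr ger0_norm.
  by rewrite ler_wsqrtr// -natrX -natrM ler_nat -XE (leq_trans mX)// leq_mul2r orbT.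
have -> : gain b = gain_const * (Num.sqrt (2 ^+ b) * (Num.sqrt (ln r) * Num.sqrt (blockvar al b))).
  by rewrite /gain sqrtrM ?exprn_ge0//; ring.
have gc0 := gain_const_gt0.
have E0 : 0 <= Num.sqrt (ln r) * Num.sqrt (blockvar al b).
  by rewrite mulr_ge0 ?sqrtr_ge0.
apply: (@le_trans _ _ (gain_const * (2 * Num.sqrt m%:R * (Num.sqrt (ln r) * Num.sqrt (blockvar al b))))).
  by rewrite ler_pM2l// ler_wpM2r.
have -> : gain_const * (2 * Num.sqrt m%:R * (Num.sqrt (ln r) * Num.sqrt (blockvar al b))) =
          t * (8 * gain_const).
  by rewrite /t mlr; field.
rewrite ler_wpM2l// /gain_const mulrC divfK ?pnatr_eq0//.
by rewrite lerD2l lerN2.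
Qed.

(** After block [b] the path has height 2^(b+1) - 1, which is low enough for
    block b+2 to be exploited next. *)
Lemma lower_chain n b (u : T) : ((height u).*2 <= 2 ^ b)%N ->
  exists C : Omega -> R,
     [/\ meas_on Z (strictly_below u) C, P.-integrable setT (EFin \o C),
         \sum_(i < n) gain (b + i.*2)%N <= \int[P]_w C w &
         forall w, exists v', [/\ (height u <= height v')%N, anc v' (height u) = u &
            C w = path_sum al Z v' (height u).+1 (height v').+1 w]].
Proof.
elim: n b u => [|n IH] b u hu.
  exists (fun=> 0); split.
  - exact: measurable_cst.
  - exact: finite_measure_integrable_cst.
  - by rewrite big_ord0 Rintegral_prob_cst.
  - move=> w; exists u; rewrite anc_height; split => //.
    by rewrite /path_sum /path_seq /index_iota subnn big_nil.
have [v hv|C HC] := @lower_step b u (\sum_(i < n) gain (b.+2 + i.*2)%N) hu.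
  by apply: IH; rewrite hv !expnS; lia.
exists C; rewrite big_ord_recl addn0 addrC.
rewrite (eq_bigr (fun i : 'I_n => gain (b.+2 + i.*2)%N)); first exact: HC.
by move=> i _; congr gain; rewrite /= /bump /=; lia.
Qed.

End lower.

(** * Upper bound by maximal inequalities in the blocks *)

(** The Cauchy-Schwarz inequality for the vectors of entries sqrt w and
    x / sqrt w. *)
Lemma weighted_Cauchy_Schwarz (R : realFieldType) (n : nat) (x w : nat -> R) :
  (forall b, 0 <= w b) -> (forall b, w b = 0 -> x b = 0) ->
  (\sum_(0 <= b < n) x b) ^+ 2 <=
  (\sum_(0 <= b < n) w b) * \sum_(0 <= b < n) (w b)^-1 * x b ^+ 2.
Proof.
move=> w0 wx; elim: n => [|n IH]; first by rewrite !big_geq// expr0n mul0r.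
rewrite !big_nat_recr//=.
have W0 : 0 <= \sum_(0 <= b < n) w b by rewrite sumr_ge0.
have B0 : 0 <= \sum_(0 <= b < n) (w b)^-1 * x b ^+ 2.
  by rewrite sumr_ge0// => b _; rewrite mulr_ge0 ?invr_ge0 ?sqr_ge0.
move: (\sum_(0 <= b < n) x b) (\sum_(0 <= b < n) w b) W0
  (\sum_(0 <= b < n) (w b)^-1 * x b ^+ 2) B0 IH => A W W0 B B0 AWB.
have [wn|wn] := eqVneq (w n) 0.
  by rewrite wn (wx _ wn) expr0n /= !addr0 mulr0 !addr0.
have wn0 : 0 < w n by rewrite lt_neqAle eq_sym wn w0.
set y := x n / w n.
have -> : x n = y * w n by rewrite /y divfK.
have -> : (w n)^-1 * (y * w n) ^+ 2 = w n * y ^+ 2 by field.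
suff h : 2 * A * y <= W * y ^+ 2 + B.
  have : w n * (2 * A * y) <= w n * (W * y ^+ 2 + B) by rewrite ler_pM2l.
  by nra.
have [WE|WN] := eqVneq W 0.
  have A0 : A = 0.
    apply/eqP; rewrite -sqrf_eq0 eq_le sqr_ge0 andbT.
    by move: AWB; rewrite WE mul0r.
  by rewrite A0 mulr0 mul0r WE mul0r add0r.
have WP : 0 < W by rewrite lt_neqAle eq_sym WN.
rewrite -(ler_pM2l WP); have := sqr_ge0 (W * y - A); nra.
Qed.

Section upper.
Variable T : rooted_tree.
Hypothesis lf : @locally_finite T.
Variables (R : realType) (al : nat -> R).
Context (d : measure_display) (Omega : measurableType d)
  (P : probability Omega R) (Z : T -> {RV P >-> R}).
Hypothesis gZ : forall v, standard_gaussian (Z v).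
Hypothesis indZ : mutually_independent Z.
Variable r : R.
Hypothesis r2 : 2 <= r.
Hypothesis nbr : forall v : T, (nb_children v)%:R <= r.

Definition first_levels (n : nat) : seq T :=
  flatten [seq descendants h (Defs.root T) | h <- iota 0 n].

Lemma mem_first_levels n v : (v \in first_levels n) = (height v < n)%N.
Proof.
apply/flattenP/idP => [[s /mapP[h]]|hv].
  rewrite mem_iota => /andP[_ hn] -> ; rewrite mem_descendants// => /andP[_ /eqP ->].
  by rewrite height_root.
exists (descendants (height v) (Defs.root T)).
  by apply/mapP; exists (height v) => //; rewrite mem_iota.
rewrite mem_descendants// height_root eqxx andbT; apply/eqP; apply: height_eq0.
by rewrite height_iter_parent subnn.
Qed.

Lemma size_first_levels n : (size (first_levels n))%:R <= r ^+ n.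
Proof.
have r0 : 0 <= r by apply: le_trans r2.
elim: n => [|n IH]; first by rewrite expr0 ler01.
rewrite /first_levels -addn1 iotaD map_cat flatten_cat size_cat natrD /= cats0 add0n.
apply: le_trans (lerD IH (size_descendants_le _ _ r0 nbr)) _.
by rewrite addn1 exprS -mulr2n -mulr_natl ler_wpM2r// exprn_ge0.
Qed.

Definition upper_const : R := 2 * max_const R.

(** The maximal inequality over the at most r^(2^(b+1)) vertices of height less
    than 2^(b+1); for taller vertices the increment over the block is that of
    an ancestor. *)
Lemma upper_block b : exists H : Omega -> R,
  [/\ measurable_fun setT H,
      (forall w, 0 <= H w) /\ (blockvar al b = 0 -> forall w, H w = 0),
      (forall v w, (height v < 2 ^ b.+1)%N ->
         path_sum al Z v (2 ^ b) (height v).+1 w ^+ 2 <= H w) &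
      (\int[P]_w (H w)%:E <= (upper_const * ln r * (2 ^+ b * blockvar al b))%:E)%E].
Proof.
have r1 : 1 <= r by apply: le_trans r2; rewrite ler1n.
have [bv0|bv0] := eqVneq (blockvar al b) 0.
  exists (fun=> 0); split => //.
    move=> v w hv; rewrite path_sum_eq0 ?expr0n// => k /andP[k1 k2].
    apply/eqP; rewrite -sqrf_eq0 eq_le sqr_ge0 andbT -bv0 /blockvar.
    rewrite (big_cat_nat (n := k))//=; last by lia.
    rewrite [X in _ + X]big_ltn; last by lia.
    by rewrite addrCA lerDl addr_ge0// sum_sqr_ge0.
  by rewrite integral0 bv0 !mulr0.
have bv1 : 0 < blockvar al b by rewrite lt_neqAle eq_sym bv0 blockvar_ge0.
have M2 : 2 <= r ^+ (2 ^ b.+1).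
  apply: le_trans r2 _; rewrite -[leLHS]expr1; apply: ler_weXn2l => //.
  by rewrite expn_gt0.
have [|H [mH H0 XH iH]] := gaussian_mgf_max (P := P)
    (X := fun v => path_sum al Z v (2 ^ b) (height v).+1) bv1 M2 (size_first_levels _).
  move=> v; rewrite mem_first_levels => hv.
  exists (\sum_(2 ^ b <= k < (height v).+1) al k ^+ 2).
    exact: gaussian_path_sum.
  by rewrite sum_sqr_le.
exists H; split => //.
- by split => //; move=> /eqP; rewrite (negPf bv0).
- by move=> v w hv; apply: XH; rewrite mem_first_levels.
- apply: le_trans iH _; rewrite lee_fin lnXn ?(lt_le_trans ltr01)//.
  rewrite -[ln r *+ _]mulr_natl natrX exprS /upper_const le_eqVlt; apply/orP; left; apply/eqP.
  ring.
Qed.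

Lemma path_sum_blocks v K w :
  \sum_(0 <= b < K) path_sum al Z v (2 ^ b) (minn (2 ^ b.+1) (height v).+1) w =
  path_sum al Z v 1 (minn (2 ^ K) (height v).+1) w.
Proof.
elim: K => [|K IH].
  by rewrite big_geq// path_sum_eq0 ?geq_minr// => k; lia.
rewrite big_nat_recr//= IH.
have KK : (2 ^ K <= 2 ^ K.+1)%N by rewrite leq_pexp2l.
have K0 : (0 < 2 ^ K)%N by rewrite expn_gt0.
case: (leqP (height v).+1 (2 ^ K)) => hK.
  rewrite (minn_idPr (leq_trans hK KK)).
  by rewrite [X in _ + X]path_sum_eq0 ?addr0// => k; lia.
rewrite -path_sum_cat//; lia.
Qed.

(** Cauchy-Schwarz with weights w_b = sqrt (2^b * blockvar b): the bounds
    H b have means at most a constant times w_b^2, so that the sum of the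
    H b / w_b has mean at most this constant times the sum of the w_b. *)
Lemma upper_bound N K : (N < 2 ^ K)%N -> al 0 = 0 -> exists H : Omega -> R,
  [/\ measurable_fun setT H, (forall w, 0 <= H w),
      (forall v w, (height v <= N)%N -> (G Z al v w) ^+ 2 <= H w) &
      (\int[P]_w (H w)%:E <= (upper_const * ln r * blocksum al K ^+ 2)%:E)%E].
Proof.
move=> NK al0.
have [H HP] := choice upper_block.
pose x b := Num.sqrt (2 ^+ b * blockvar al b).
have x0 b : 0 <= x b by exact: sqrtr_ge0.
have x2 b : x b ^+ 2 = 2 ^+ b * blockvar al b.
  by rewrite sqr_sqrtr// mulr_ge0 ?exprn_ge0 ?blockvar_ge0.
have W0 : 0 <= blocksum al K by rewrite sumr_ge0.
pose F b w := (x b)^-1 * H b w.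
have F0 b w : 0 <= F b w.
  by have [_ [H0 _] _ _] := HP b; rewrite mulr_ge0 ?invr_ge0.
have mF b : measurable_fun setT (F b).
  by have [mH _ _ _] := HP b; apply: measurable_funM.
have mSF : measurable_fun setT (fun w => \sum_(0 <= b < K) F b w).
  exact: measurable_sum_seq.
have c0 : 0 <= upper_const * ln r.
  rewrite mulr_ge0//; last by rewrite ln_ge0// (le_trans _ r2)// ler1n.
  by rewrite /upper_const /max_const mulr_ge0// addr_ge0// divr_ge0// sqr_ge0.
exists (fun w => blocksum al K * \sum_(0 <= b < K) F b w); split.
- exact: measurable_funM.
- by move=> w; rewrite mulr_ge0// sumr_ge0.
- move=> v w hv.
  pose y b := path_sum al Z v (2 ^ b) (minn (2 ^ b.+1) (height v).+1) w.
  have yH b : y b ^+ 2 <= H b w.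
    have [_ _ XH _] := HP b.
    pose k := minn (2 ^ b.+1).-1 (height v).
    have E0 : (0 < 2 ^ b.+1)%N by rewrite expn_gt0.
    have kv : (k <= height v)%N by exact: geq_minr.
    have k1 : k.+1 = minn (2 ^ b.+1) (height v).+1 by rewrite /k; lia.
    have := XH (anc v k) w; rewrite height_anc//.
    rewrite /path_sum anc_path_seq// k1 -/(path_sum _ _ _ _ _ _); apply; rewrite /k; lia.
  have GE : G Z al v w = \sum_(0 <= b < K) y b.
    rewrite path_sum_blocks G_path_sum (path_sum_cat al Z v w (n := 1))//.
    rewrite path_sum_eq0 ?add0r//; last by case.
    by congr path_sum; lia.
  rewrite GE; apply: le_trans (weighted_Cauchy_Schwarz (w := x) _ x0 _) _.
    move=> b xb0; apply/eqP; rewrite -sqrf_eq0 eq_le sqr_ge0 andbT.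
    have /eqP : 2 ^+ b * blockvar al b = 0 by rewrite -x2 xb0 expr0n.
    rewrite mulf_eq0 expf_eq0 pnatr_eq0 andbF /= => /eqP bv.
    by have [_ [_ Hbv] _ _] := HP b; rewrite (le_trans (yH b))// Hbv.
  rewrite ler_wpM2l// ler_sum// => b _.
  by rewrite ler_wpM2l ?invr_ge0.
- under eq_integral do rewrite EFinM.
  rewrite ge0_integralZl//; last 2 first.
  + by apply/measurable_EFinP.
  + by move=> w _; rewrite lee_fin sumr_ge0.
  apply: (@le_trans _ _ ((blocksum al K)%:E * (\sum_(0 <= b < K) upper_const * ln r * x b)%:E)%E).
    rewrite lee_wpmul2l ?lee_fin//; apply: le_integral_sum => // b _.
    have [mH [H0 _] _ iH] := HP b.
    under eq_integral do rewrite EFinM.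
    rewrite ge0_integralZl ?lee_fin ?invr_ge0//; last 2 first.
    + by apply/measurable_EFinP.
    + by move=> w _; rewrite lee_fin.
    apply: le_trans (lee_wpmul2l _ iH) _; first by rewrite lee_fin invr_ge0.
    rewrite -EFinM lee_fin -x2 mulrCA.
    have [->|xb] := eqVneq (x b) 0; first by rewrite invr0 mul0r !mulr0.
    by rewrite expr2 mulKf.
  by rewrite -EFinM lee_fin -mulr_sumr mulrCA expr2.
Qed.

End upper.

(** * Second moment of the supremum of the field *)

(** Padding the finite family to a sequence makes it a supremum of a sequence
    of measurable functions. *)
Lemma measurable_ereal_sup_seq (d : measure_display) (T : measurableType d)
    (R : realType) (K : eqType) (x0 : K) (s : seq K) (f : K -> T -> \bar R) :
  x0 \in s -> (forall k, k \in s -> measurable_fun setT (f k)) ->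
  measurable_fun setT (fun w => ereal_sup [set f k w | k in [set` s]]).
Proof.
move=> x0s mf.
rewrite (_ : (fun w => _) = (fun w => esups (fun n => f (nth x0 s n) w) 0%N)).
  apply: (@measurable_fun_esups _ _ _ _ (fun n => f (nth x0 s n))) => n.
  apply: mf; case: (ltnP n (size s)) => ns; first exact: mem_nth.
  by rewrite nth_default.
apply/funext => w; rewrite /esups /=; congr ereal_sup.
apply/seteqP; split => y /= [].
  by move=> k ks <-; exists (index k s) => //=; rewrite nth_index.
move=> n _ <-; case: (ltnP n (size s)) => ns.
  by exists (nth x0 s n) => //=; exact: mem_nth.
by exists x0 => //=; rewrite nth_default.
Qed.

(** Jensen's inequality in the form C^2 >= 2 m C - m^2, with m the mean of [C];
    the right-hand side is integrable whenever [C] is. *)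
Lemma sqr_mean_le_integral (d : measure_display) (Omega : measurableType d)
    (R : realType) (P : probability Omega R) (C : Omega -> R) (F : Omega -> \bar R) :
  P.-integrable setT (EFin \o C) -> measurable_fun setT F ->
  (forall w, ((C w) ^+ 2)%:E <= F w)%E ->
  (((\int[P]_w C w) ^+ 2)%:E <= \int[P]_w F w)%E.
Proof.
move=> iC mF CF; set m := Rintegral _ _ _.
have i1 : P.-integrable setT (EFin \o (fun w => 2 * m * C w)).
  exact: (integrableZl measurableT (2 * m) iC).
have i2 : P.-integrable setT (EFin \o (fun w : Omega => m ^+ 2)).
  exact: finite_measure_integrable_cst.
have i3 : P.-integrable setT (EFin \o (fun w => 2 * m * C w - m ^+ 2)).
  exact: (integrableB measurableT i1 i2).
have i4 : P.-integrable setT (EFin \o (fun w => Num.max (2 * m * C w - m ^+ 2) 0)).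
  apply: (le_integrable measurableT _ _ i3) => //.
    apply/measurable_EFinP; apply: measurable_maxr => //.
    by apply/measurable_EFinP; exact: measurable_int i3.
  move=> w _; rewrite /= lee_fin ger0_norm ?le_max ?lexx ?orbT//.
  by rewrite ge_max normr_ge0 ler_norm.
apply: (@le_trans _ _ (\int[P]_w (2 * m * C w - m ^+ 2)%:E)%E).
  rewrite -[leRHS]fineK ?integrable_fin_num// lee_fin.
  rewrite -/(Rintegral _ _ _) RintegralB// RintegralZl// Rintegral_prob_cst -/m.
  by have -> : 2 * m * m - m ^+ 2 = m ^+ 2 by ring.
apply: (@le_trans _ _ (\int[P]_w (Num.max (2 * m * C w - m ^+ 2) 0)%:E)%E).
  by apply: le_integral => // w _; rewrite lee_fin le_max lexx.
apply: ge0_le_integral => //.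
- by move=> w _; rewrite lee_fin le_max lexx orbT.
- exact: measurable_int i4.
- move=> w _; apply: le_trans (CF w); rewrite lee_fin ge_max sqr_ge0 andbT.
  by have := sqr_ge0 (C w - m); nra.
Qed.

Section main.
Variable T : rooted_tree.
Hypothesis lf : @locally_finite T.
Variables (R : realType).
Context (d : measure_display) (Omega : measurableType d)
  (P : probability Omega R) (Z : T -> {RV P >-> R}).
Hypothesis gZ : forall v, standard_gaussian (Z v).
Hypothesis indZ : mutually_independent Z.
Variables (N : nat) (a : N.-tuple R).

Let al := extend a.
Definition supG2 (w : Omega) : \bar R :=
  ereal_sup [set ((G Z al v w) ^+ 2)%:E | v in [set v | (height v <= N)%N]].

Lemma measurable_supG2 : measurable_fun setT supG2.
Proof.
rewrite /supG2 (_ : [set v | (height v <= N)%N] = [set` first_levels T N.+1]); last first.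
  by apply/seteqP; split => v /=; rewrite mem_first_levels.
apply: (@measurable_ereal_sup_seq _ _ _ _ (Defs.root T)).
  by rewrite mem_first_levels// height_root.
move=> v _; apply/measurable_EFinP; apply: measurable_funX.
have -> : G Z al v = path_sum al Z v 0 (height v).+1 by apply/funext => w; exact: G_path_sum.
by have [] := gaussian_path_sum al gZ indZ 0 (leqnn (height v).+1).
Qed.

Lemma G_sqr_le_sup v w : (height v <= N)%N -> (((G Z al v w) ^+ 2)%:E <= supG2 w)%E.
Proof. by move=> vN; apply: ereal_sup_ubound; exists v. Qed.

Lemma supG2_ge0 w : (0 <= supG2 w)%E.
Proof.
apply: le_trans (@G_sqr_le_sup (Defs.root T) w _); first by rewrite lee_fin sqr_ge0.
by rewrite height_root.
Qed.

(** The coefficients vanish beyond level [N], so a tall vertex has the same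
    value as its ancestor at level [N]. *)
Lemma path_sum_sqr_le_sup v w : (((path_sum al Z v 1 (height v).+1 w) ^+ 2)%:E <= supG2 w)%E.
Proof.
pose k := minn N (height v).
have kv : (k <= height v)%N by exact: geq_minr.
rewrite (_ : path_sum al Z v 1 (height v).+1 w = G Z al (anc v k) w).
  by apply: G_sqr_le_sup; rewrite height_anc// geq_minl.
rewrite G_path_sum height_anc// {2}/path_sum anc_path_seq// -/(path_sum _ _ _ _ _ _).
rewrite (path_sum_cat al Z v w (m := 0) (n := 1))// [X in _ = X + _]path_sum_eq0//; last by case.
rewrite add0r (path_sum_cat al Z v w (m := 1) (n := k.+1))//.
rewrite [X in _ + X]path_sum_eq0 ?addr0// => j kj; apply: extend_gt.
rewrite /k in kj; lia.
Qed.

Lemma lower_chain_sup (r : R) n e : 2 <= r -> (forall v : T, r <= (nb_children v)%:R) ->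
  (((\sum_(i < n) gain al r (e + i.*2)%N) ^+ 2)%:E <= \int[P]_w supG2 w)%E.
Proof.
move=> r2 nbr.
have [|C [_ iC EC CG]] := lower_chain lf al gZ indZ r2 nbr n (b := e) (u := Defs.root T).
  by rewrite height_root.
apply: (@le_trans _ _ (((\int[P]_w C w) ^+ 2)%:E)).
  rewrite lee_fin ler_sqr ?nnegrE//.
    by apply: sumr_ge0 => i _; exact: gain_ge0.
  by apply: le_trans EC; apply: sumr_ge0 => i _; exact: gain_ge0.
apply: sqr_mean_le_integral => //; first exact: measurable_supG2.
move=> w; have [v [_ _ ->]] := CG w; rewrite height_root.
exact: path_sum_sqr_le_sup.
Qed.

Lemma lower_estimate (r : R) : 2 <= r -> (forall v : T, r <= (nb_children v)%:R) ->
  ((gain_const R / 6 * Num.sqrt (ln r))%:E * Q al <= sqrte (\int[P]_w supG2 w))%E.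
Proof.
move=> r2 nbr; have I0 : (0 <= \int[P]_w supG2 w)%E.
  by apply: integral_ge0 => w _; exact: supG2_ge0.
have K1 : (N < 2 ^ N.*2)%N.
  by apply: leq_trans (ltn_expl N (ltnSn 1)) _; rewrite leq_pexp2l// -addnn leq_addr.
rewrite (Q_extend a K1) -EFinM.
pose m e : R := \sum_(i < N) gain al r (e + i.*2)%N.
have mS e : ((m e)%:E <= sqrte (\int[P]_w supG2 w))%E.
  have m0 : 0 <= m e by apply: sumr_ge0 => i _; exact: gain_ge0.
  have -> : (m e)%:E = sqrte ((m e) ^+ 2)%:E by rewrite /= sqrtr_sqr ger0_norm.
  by rewrite lee_sqrt//; exact: lower_chain_sup.
have mE : m 0%N + m 1%N = gain_const R * Num.sqrt (ln r) * blocksum al N.*2.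
  rewrite /m /blocksum; elim: (N) => [|n IH].
    by rewrite !big_ord0 big_geq// mulr0 addr0.
  rewrite !big_ord_recr /= doubleS !big_nat_recr//= !mulrDr -IH /gain add0n add1n.
  by ring.
have QW := Qsum_le_blocksum al N.*2.
have c0 : 0 <= gain_const R * Num.sqrt (ln r).
  by rewrite mulr_ge0 ?sqrtr_ge0// ltW// gain_const_gt0.
have h : gain_const R / 6 * Num.sqrt (ln r) * Qsum al (2 ^ N.*2) <= (m 0%N + m 1%N) / 2.
  have := ler_wpM2l c0 QW; rewrite mE; lra.
case: (leP (m 0%N) (m 1%N)) => m01; [apply: le_trans (mS 1%N)|apply: le_trans (mS 0%N)];
  rewrite lee_fin; lra.
Qed.

Lemma upper_estimate (r : R) : 2 <= r -> (forall v : T, (nb_children v)%:R <= r) ->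
  (sqrte (\int[P]_w supG2 w) <= (2 * Num.sqrt (upper_const R) * Num.sqrt (ln r))%:E * Q al)%E.
Proof.
move=> r2 nbr.
have K1 : (N < 2 ^ N)%N by exact: ltn_expl.
rewrite (Q_extend a K1) -EFinM.
have [H [mH H0 GH iH]] := upper_bound lf gZ indZ r2 nbr K1 (extend0 a).
have lr0 : 0 <= ln r by rewrite ln_ge0// (le_trans _ r2)// ler1n.
have u0 : 0 <= upper_const R.
  by rewrite /upper_const /max_const mulr_ge0// addr_ge0// divr_ge0// sqr_ge0.
have W0 : 0 <= blocksum al N by apply: sumr_ge0 => b _; exact: sqrtr_ge0.
apply: (@le_trans _ _ (sqrte (upper_const R * ln r * blocksum al N ^+ 2)%:E)).
  rewrite lee_sqrt; last first.
    by rewrite lee_fin; apply: mulr_ge0; [exact: mulr_ge0|exact: sqr_ge0].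
  apply: le_trans iH; apply: ge0_le_integral => //.
  - by move=> w _; exact: supG2_ge0.
  - exact: measurable_supG2.
  - exact/measurable_EFinP.
  - by move=> w _; apply: ub_ereal_sup => _ [v vN <-]; rewrite lee_fin GH.
rewrite /= lee_fin (sqrtrM _ (mulr_ge0 u0 lr0)) sqrtr_sqr ger0_norm// (sqrtrM _ u0).
have := blocksum_le_Qsum al N.
have := mulr_ge0 (sqrtr_ge0 (upper_const R)) (sqrtr_ge0 (ln r)).
move: (Num.sqrt (upper_const R)) (Num.sqrt (ln r)) => x y xy QW.
have -> : 2 * x * y * Qsum al (2 ^ N) = x * y * (2 * Qsum al (2 ^ N)) by ring.
by rewrite ler_wpM2l.
Qed.

End main.

Theorem corollary1p4 (R : realType) :
  exists c1 c2 : R, 0 < c1 /\ 0 < c2 /\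
    forall (T : rooted_tree),
      locally_finite T -> without_leaves T ->
      (2%:E <= Dmin T R)%E -> (Dmin T R <= Dmax T R)%E -> (Dmax T R < +oo)%E ->
    forall (d : measure_display) (Omega : measurableType d)
      (P : probability Omega R) (Z : T -> {RV P >-> R}),
      (forall v, standard_gaussian (Z v)) -> mutually_independent Z ->
    forall (N : nat) (a : N.-tuple R),
      let alpha := extend a in
      let S := sqrte (\int[P]_w
        ereal_sup [set ((G Z alpha v w) ^+ 2)%:E | v in [set v | (height v <= N)%N]])%E in
      (c1%:E * sqrte (lne (Dmin T R)) * Q alpha <= S)%E /\
      (S <= c2%:E * sqrte (lne (Dmax T R)) * Q alpha)%E.
Proof.
exists (gain_const R / 6), (2 * Num.sqrt (upper_const R)); split.
  by rewrite divr_gt0// gain_const_gt0.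
split.
  rewrite mulr_gt0// sqrtr_gt0 /upper_const /max_const mulr_gt0// ltr_wpDr//.
  by rewrite divr_ge0// sqr_ge0.
move=> T lf _ Dmin2 DminDmax Dmaxy d Omega P Z gZ indZ N a alpha S.
have Dmax2 : (2%:E <= Dmax T R)%E by exact: le_trans DminDmax.
have [r rE] : exists r, Dmin T R = r%:E.
  exists (fine (Dmin T R)); rewrite fineK// fin_numElt.
  by rewrite (lt_le_trans _ Dmin2) ?ltNyr// (le_lt_trans DminDmax).
have [r' rE'] : exists r, Dmax T R = r%:E.
  exists (fine (Dmax T R)); rewrite fineK// fin_numElt.
  by rewrite (lt_le_trans _ Dmax2) ?ltNyr.
have nbr (v : T) : r <= (nb_children v)%:R.
  by rewrite -lee_fin -rE; apply: ereal_inf_lbound; exists v.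
have nbr' (v : T) : (nb_children v)%:R <= r'.
  by rewrite -lee_fin -rE'; apply: ereal_sup_ubound; exists v.
rewrite rE rE' !lee_fin in Dmin2 Dmax2 *.
have r0 : 0 < r by apply: lt_le_trans Dmin2.
have r0' : 0 < r' by apply: lt_le_trans Dmax2.
rewrite !lne_EFin//=; split.
- exact: (lower_estimate lf gZ indZ a Dmin2 nbr).
- exact: (upper_estimate lf gZ indZ a Dmax2 nbr').
Qed.
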